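(* For every nonnegative integer $w$, \[ \sum_{\lambda:\lambda_1\le 2w+1} s_{\lambda}(\mathbf{x}) = e(\mathbf{x}) \det_{1\le i,j \leq w}\left((p_1^{\perp})^{i+j-2} (f_{0}(\mathbf{x})-f_{2}(\mathbf{x}))\right) \] and \[ \sum_{\lambda:\lambda_1\le 2w} s_{\lambda}(\mathbf{x}) = \det_{1\le i,j \leq w}\left((p_1^{\perp})^{i+j-2}(f_0(\mathbf{x})+f_1(\mathbf{x}))\right). \]
   Context: Symmetric functions are in infinitely many variables $\mathbf{x}=(x_1,x_2,\dots)$ (formal power series). The sums range over all partitions $\lambda$ with largest part $\lambda_1$ bounded as indicated; $s_\lambda(\mathbf{x})$ is the Schur function. $e_n(\mathbf{x})$ is the $n$-th elementary symmetric function ($e_0=1$, $e_n=0$ for $n<0$), $f_r(\mathbf{x})=\sum_{n\in\mathbb{Z}} e_n(\mathbf{x})e_{n+r}(\mathbf{x})$ for $r\in\mathbb{Z}$, and $e(\mathbf{x})=\sum_{n\ge0}e_n(\mathbf{x})$. The Hall inner product is defined by $\langle s_\lambda,s_\mu\rangle=\delta_{\lambda,\mu}$; for a symmetric function $f$, the skewing operator $f^\perp$ is the adjoint of multiplication by $f$ with respect to this inner product. $p_1(\mathbf{x})=x_1+x_2+\cdots$ is the first power sum. The determinant of an empty matrix is $1$. *)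

(* Defs.v *)
From HB Require Import structures.
From mathcomp Require Import all_boot all_order all_algebra.
From mathcomp Require Import finmap multiset.
From mathcomp Require Import boolp classical_sets functions cardinality fsbigop.

Set Implicit Arguments.
Unset Strict Implicit.
Unset Printing Implicit Defensive.

Import GRing.Theory.
Local Open Scope classical_set_scope.
Local Open Scope ring_scope.

(* A monomial in the variables x_0, x_1, x_2, ... is the finite multiset of the indices of its
   variables: x_{i_1} x_{i_2} ... x_{i_n} is [seq_mset [:: i_1; ...; i_n]], and the product of
   monomials is the sum [msetD] of multisets. *)
Notation monom := {mset nat}%mset.

(* Formal power series in x_0, x_1, ...; [F m] is the coefficient of the monomial [m]. *)
Definition fps (R : Type) := monom -> R.

HB.instance Definition _ (R : zmodType) := GRing.Zmodule.copy (fps R) (monom -> R).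

Section Ring.
Variable R : comNzRingType.
Implicit Types (F G H : fps R) (m : monom).

Definition fps_one : fps R := fun m => (m == mset0)%:R.

Definition fps_mul F G : fps R :=
  fun m => \sum_(p \in [set p : monom * monom | msetD p.1 p.2 = m]) F p.1 * G p.2.

Let splits m := [set p : monom * monom | msetD p.1 p.2 = m].

Lemma splits_finite m : finite_set (splits m).
Proof.
rewrite -[m]seq_mset_id; elim: (enum_mset m) => [|a s IHs].
  apply: (@sub_finite_set _ _ [set (mset0, mset0)]); last exact: finite_set1.
  move=> [p q] /= pq; have eq0 i : (p i = 0 /\ q i = 0)%N.
    move: pq => /(congr1 (fun A : {mset nat}%mset => A i)).
    by rewrite msetE2 mset_seqE /=; case: (p i) (q i) => [|?] [].
  by congr pair; apply/msetP => i; rewrite mset0E; case: (eq0 i).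
pose f (p : monom * monom) : monom * monom := (msetD (msetn 1 a) p.1, p.2).
pose g (p : monom * monom) : monom * monom := (p.1, msetD (msetn 1 a) p.2).
apply: (@sub_finite_set _ _
  (f @` splits (seq_mset s) `|` g @` splits (seq_mset s))); last first.
  by rewrite finite_setU; split; apply: finite_image.
move=> [p q] /= pq.
have pqE i : (p i + q i = (a == i) + count_mem i s)%N.
  move: pq => /(congr1 (fun A : {mset nat}%mset => A i)).
  by rewrite msetE2 mset_seqE.
have [ap|/mset_eq0P ap] := boolP (a \in p).
  left; exists (msetB p (msetn 1 a), q); last by rewrite /f /= msetB1K.
  apply/msetP => i /=; rewrite msetE2 msetB1E mset_seqE.
  have := pqE i; rewrite eq_sym; case: eqP => [->|_]; last by rewrite subn0.
  move: ap; rewrite in_mset => ap /=; rewrite add1n.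
  by rewrite addnBAC // => ->; rewrite subn1.
have aq : a \in q.
  by rewrite in_mset; have := pqE a; rewrite ap eqxx add0n => ->.
right; exists (p, msetB q (msetn 1 a)); last by rewrite /g /= msetB1K.
apply/msetP => i /=; rewrite msetE2 msetB1E mset_seqE.
have := pqE i; rewrite eq_sym; case: eqP => [->|_]; last by rewrite subn0.
move: aq; rewrite in_mset => aq /=; rewrite add1n.
by rewrite addnBA // => ->; rewrite subn1.
Qed.

Let D m : seq (monom * monom) := fset_set (splits m).

Let mem_D m p : (p \in D m) = (msetD p.1 p.2 == m).
Proof.
rewrite /D in_fset_set; last exact: splits_finite.
by apply/idP/eqP => [/set_mem //|pm]; apply/mem_set.
Qed.

Let D_uniq m : uniq (D m). Proof. exact: fset_uniq. Qed.

Lemma fps_mulE F G m : fps_mul F G m = \sum_(p <- fset_set (splits m)) F p.1 * G p.2.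
Proof. by rewrite /fps_mul fsbig_finite //; exact: splits_finite. Qed.

Let fps_mulC : commutative fps_mul.
Proof.
move=> F G; apply/funext => m; rewrite !fps_mulE -/(D m).
pose sw (p : monom * monom) := (p.2, p.1).
have sw_inj : injective sw by move=> [? ?] [? ?] [-> ->].
rewrite (perm_big (map sw (D m))) /=.
  by rewrite big_map; apply: eq_bigr => p _; rewrite mulrC.
apply: uniq_perm; rewrite ?map_inj_uniq // => -[p q].
have -> : (p, q) = sw (q, p) by [].
by rewrite mem_map // !mem_D /= msetDC.
Qed.

Let fps_mulA : associative fps_mul.
Proof.
move=> F G H; apply/funext => m; rewrite !fps_mulE -!/(D m).
pose L1 := [seq (p.1, q.1, q.2) | p <- D m, q <- D p.2].
pose L2 := [seq (q.1, q.2, p.2) | p <- D m, q <- D p.1].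
transitivity (\sum_(t <- L1) F t.1.1 * G t.1.2 * H t.2).
  rewrite big_allpairs_dep; apply: eq_bigr => p _.
  by rewrite fps_mulE big_distrr /=; apply: eq_bigr => q _; rewrite mulrA.
transitivity (\sum_(t <- L2) F t.1.1 * G t.1.2 * H t.2); last first.
  rewrite big_allpairs_dep; apply: eq_bigr => p _.
  by rewrite fps_mulE big_distrl.
pose pr2 (u : {_ : monom * monom & (monom * monom)%type}) := projT2 u.
apply: perm_big; apply: uniq_perm.
- apply: allpairs_uniq_dep => // -[p q] [p' q'].
  move=> /allpairsPdep [x [y [_ + E]]]; rewrite mem_D => /eqP yE.
  move=> /allpairsPdep [x' [y' [_ + E']]]; rewrite mem_D => /eqP yE'.
  have /= px := congr1 (@projT1 _ _) E; have /= qy := congr1 pr2 E.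
  have /= px' := congr1 (@projT1 _ _) E'; have /= qy' := congr1 pr2 E'.
  move: yE yE'; rewrite {}px {}qy {}px' {}qy' {E E'}.
  case: x y x' y' => [x1 x2] [y1 y2] [x1' x2'] [y1' y2'] /=.
  by move=> <- <- [-> -> ->].
- apply: allpairs_uniq_dep => // -[p q] [p' q'].
  move=> /allpairsPdep [x [y [_ + E]]]; rewrite mem_D => /eqP yE.
  move=> /allpairsPdep [x' [y' [_ + E']]]; rewrite mem_D => /eqP yE'.
  have /= px := congr1 (@projT1 _ _) E; have /= qy := congr1 pr2 E.
  have /= px' := congr1 (@projT1 _ _) E'; have /= qy' := congr1 pr2 E'.
  move: yE yE'; rewrite {}px {}qy {}px' {}qy' {E E'}.
  case: x y x' y' => [x1 x2] [y1 y2] [x1' x2'] [y1' y2'] /=.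
  by move=> <- <- [-> -> ->].
move=> [[a b] c].
transitivity (msetD (msetD a b) c == m).
  apply/allpairsPdep/eqP => [[p [q []]]|<-].
    by rewrite !mem_D => /eqP <- /eqP <- [-> -> ->]; rewrite msetDA.
  by exists (a, msetD b c), (b, c); rewrite !mem_D /= msetDA.
symmetry; apply/allpairsPdep/eqP => [[p [q []]]|<-].
  by rewrite !mem_D => /eqP <- /eqP <- [-> -> ->].
by exists (msetD a b, c), (a, b); rewrite !mem_D /= !eqxx.
Qed.

Let fps_mul1 : left_id fps_one fps_mul.
Proof.
move=> F; apply/funext => m; rewrite fps_mulE -/(D m) (bigD1_seq (mset0, m)) //=.
  rewrite /fps_one eqxx mul1r big_seq_cond big1 ?addr0 // => -[p q].
  rewrite mem_D /= => /andP[/eqP <- ne].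
  have [p0|_] := eqVneq p mset0; last by rewrite mul0r.
  by move: ne; rewrite p0 mset0D eqxx.
by rewrite mem_D /= mset0D.
Qed.

Let fps_mulDl : left_distributive fps_mul +%R.
Proof.
move=> F G H; apply/funext => m.
have -> : (fps_mul F H + fps_mul G H) m = fps_mul F H m + fps_mul G H m by [].
by rewrite !fps_mulE -big_split; apply: eq_bigr => p _ /=; rewrite -mulrDl.
Qed.

Let fps_1neq0 : fps_one != 0 :> fps R.
Proof.
apply/eqP => /(congr1 (fun F => F mset0)); rewrite /fps_one eqxx.
by move/eqP; rewrite oner_eq0.
Qed.

HB.instance Definition _ := GRing.Zmodule_isComNzRing.Build (fps R)
  fps_mulA fps_mulC fps_mul1 fps_mulDl fps_1neq0.

End Ring.

Section SymmetricFunctions.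
Variable R : comNzRingType.
Implicit Types (F G f g h k : fps R) (la : seq nat).

(* The possibly infinite formal sum of the series [F i], i in A: every coefficient is a sum
   with finitely many nonzero terms (the sum of a family which is not locally finite has the
   junk coefficient 0 where it diverges). *)
Definition fsum (I : choiceType) (A : set I) (F : I -> fps R) : fps R :=
  fun m => \sum_(i \in A) F i m.

(* The series consisting of the single monomial x_{i_1} ... x_{i_n}, for s = [:: i_1; ...; i_n]. *)
Definition mono (s : seq nat) : fps R := fun m => (m == seq_mset s)%:R.

Definition is_part la : Prop := sorted geq la /\ 0%N \notin la.

(* Semistandard Young tableaux of shape [la], as the sequence of their rows: rows weakly
   increase, columns strictly increase. *)
Definition is_ssyt la (T : seq (seq nat)) : Prop :=
  [/\ shape T = la,
      forall i, sorted leq (nth [::] T i)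
    & forall i j, (j < nth 0 la i.+1)%N ->
        (nth 0 (nth [::] T i) j < nth 0 (nth [::] T i.+1) j)%N].

Definition schur la : fps R := fsum [set T | is_ssyt la T] (fun T => mono (flatten T)).

Definition elem (n : int) : fps R :=
  if n is Posz k then fsum [set s : seq nat | sorted ltn s /\ size s = k] mono else 0.

Definition esum : fps R := fsum [set: nat] (fun n => elem n%:Z).

Definition fser (r : int) : fps R := fsum [set: int] (fun n => elem n * elem (n + r)).

Definition psum1 : fps R := fsum [set: nat] (fun i => mono [:: i]).

(* Symmetric series, possibly of unbounded degree (such as [esum] and [fser r]). *)
Definition sym_series F : Prop :=
  forall sigma : nat -> nat, bijective sigma ->
  forall s : seq nat, F (seq_mset (map sigma s)) = F (seq_mset s).

(* Symmetric functions: symmetric series of bounded degree. *)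
Definition sym_fun F : Prop :=
  sym_series F /\ exists d : nat, forall s : seq nat, (d < size s)%N -> F (seq_mset s) = 0.

(* The coefficients of [F] in the Schur functions; unique at partitions when [F] is symmetric,
   and unspecified at sequences that are not partitions. *)
Definition schur_coef F : seq nat -> R :=
  xget (fun _ => 0)
    [set c | F = fsum [set la | is_part la] (fun la m => c la * schur la m)].

(* The Hall inner product, for which the Schur functions are orthonormal. It makes sense for a
   symmetric series [F] and a symmetric function [G]: finitely many terms are then nonzero. *)
Definition hall F G : R :=
  \sum_(la \in [set la | is_part la]) schur_coef F la * schur_coef G la.

(* f^perp, the adjoint of the multiplication by the symmetric function [f]. As it lowers
   degrees by a bounded amount, it acts on all symmetric series: f^perp g is the symmetric
   series determined by its pairings with the symmetric functions. *)
Definition skewing f g : fps R :=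
  xget 0 [set h | sym_series h /\ forall k, sym_fun k -> hall h k = hall g (f * k)].

End SymmetricFunctions.

Arguments schur {R} la.
Arguments esum {R}.
Arguments fser {R} r.
Arguments psum1 {R}.

(* Main.v *)
(** Removing one variable [x] from a series in the [e_n] replaces [e_n] by [e_n + x e_(n-1)].
    A product [t(a)] of such series, depending on integers [a_1, ..., a_k], therefore becomes
    the sum over the subsets [e] of the columns of [x^|e| t(a + e)]; after alternating over
    [a] only the subsets that keep [a] strictly decreasing survive, and iterating produces
    exactly the semistandard tableaux with at most [k] columns. With [t(a)] a product of
    [e_(b_i - a_i)] this is the dual Jacobi-Trudi formula. With [t(a)] a product of
    [q_(a_i - a_j)] over disjoint pairs (times [e] if [k] is odd), where
    [q_(d+1) - q_d = f_d + f_(d+1)] and [q_(-d) = - q_d], it expresses the sum of the Schur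
    functions with [la_1 <= k] as a multiple of a Pfaffian of the matrix [(q_(j-i))].

    On symmetric series, [p_1^perp] extracts the coefficient of a fresh variable, so
    [p_1^perp q_d = q_(d-1) + q_(d+1)]. Hence in the basis of polynomials
    [(z+1) (1+z^2)^i z^(w-1-i)], [(z-1) (1+z^2)^i z^(w-1-i)] for [k = 2w], and
    [(z^2-1) (1+z^2)^i z^(w-1-i)], [(z-1)^2 (1+z^2)^i z^(w-1-i)], [z^w] for [k = 2w+1], the
    matrix has two zero diagonal blocks, its off-diagonal blocks are twice the Hankel
    matrix of the theorem up to sign, and the Pfaffian is a multiple of its determinant.
    The multiple is found by comparing constant terms: the constant term of the Hankel matrix
    counts walks on a half-line and has determinant 1. *)

Require Import Defs.
From HB Require Import structures.
From mathcomp Require Import all_boot all_order all_algebra.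
From mathcomp Require Import finmap multiset.
From mathcomp Require Import boolp classical_sets functions cardinality fsbigop.
From mathcomp Require Import perm zify ring.

Set Implicit Arguments.
Unset Strict Implicit.
Unset Printing Implicit Defensive.

Import Order.TTheory GRing.Theory Num.Theory.
Local Open Scope classical_set_scope.
Local Open Scope ring_scope.

(** * Coefficients and specialisation of variables *)

(** There are infinitely many variables, so the recursion is run on one coefficient at a time:
    variables from some bound [N] on are set to zero, the others are removed one by one, and a
    constant term remains. For the [e] product this constant is the indicator of one vector of
    column heights, whence Jacobi-Trudi. For the [q] product it is a signed sum of products of
    signs, because [q_d] has constant term the sign of [d]; it is therefore the same for all
    decreasing arguments, and every tableau is counted equally. Neither this constant, nor the
    determinant of the change of basis, nor the Pfaffian of the standard pairing is evaluated: it
    suffices that the last one is positive, and dividing by it is why the coefficients are rational.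
    The second obstacle is that skewing is an adjoint picked by choice. Identifying it with the
    fresh-variable coefficient takes the unitriangularity of the Schur functions and two Pieri
    rules, both derived from the determinant formula. *)

Lemma fsum_seq (R : comNzRingType) (I : choiceType) (A : set I) (r : seq I) (F : I -> R) :
  uniq r -> (forall i, i \in r -> A i) -> (forall i, A i -> F i != 0 -> i \in r) ->
  \sum_(i \in A) F i = \sum_(i <- r) F i.
Proof.
move=> ur rA Ar; rewrite (fsbigE r) //; last first.
  by move=> i Ai; apply: contraNeq => /(Ar _ Ai).
by rewrite big_seq_cond [RHS]big_seq_cond; apply: eq_bigl => i /=;
  case: (boolP (i \in r)) => //= /rA Ai; rewrite mem_set.
Qed.

Lemma seq_mset_cat (s t : seq nat) : seq_mset (s ++ t) = msetD (seq_mset s) (seq_mset t).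
Proof. by apply/msetP => i; rewrite msetE2 !mset_seqE count_cat. Qed.

Lemma mset1_seq (v : nat) : seq_mset [:: v] = msetn 1 v.
Proof. by rewrite mset_cons; apply/msetP => i; rewrite msetE2 mset_seqE /= addn0. Qed.

Lemma msetD_inj (m p q : monom) : msetD m p = msetD m q -> p = q.
Proof. by move=> /(congr1 (fun z => msetB z m)); rewrite !msetDKB. Qed.

Lemma all_seq_mset (P : pred nat) s : all P (seq_mset s) = all P s.
Proof. by apply: perm_all; apply: perm_eq_seq_mset. Qed.

Lemma size_seq_mset (s : seq nat) : size (seq_mset s) = size s.
Proof. by apply: perm_size; apply: perm_eq_seq_mset. Qed.

Lemma all_msetD (P : pred nat) (p q : monom) : all P (msetD p q) = all P p && all P q.
Proof.
by rewrite -{1}[p]seq_mset_id -{1}[q]seq_mset_id -seq_mset_cat all_seq_mset all_cat.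
Qed.

Lemma size_msetD (p q : monom) : size (msetD p q) = (size p + size q)%N.
Proof.
by rewrite -{1}[p]seq_mset_id -{1}[q]seq_mset_id -seq_mset_cat size_seq_mset size_cat.
Qed.

Lemma mset_size0 (m : monom) : size m = 0%N -> m = mset0.
Proof. by move=> /size0nil s0; rewrite -[m]seq_mset_id s0; apply/msetP => i; rewrite mset_seqE mset0E. Qed.

Section Coefficients.
Variable R : comNzRingType.
Implicit Types (F G H : fps R) (m p q : monom) (P : pred nat).

Lemma fps_addE F G m : (F + G) m = F m + G m. Proof. by []. Qed.
Lemma fps_oppE F m : (- F) m = - F m. Proof. by []. Qed.

Lemma fps_sumE (I : Type) (r : seq I) (Q : pred I) (F : I -> fps R) m :
  (\sum_(i <- r | Q i) F i) m = \sum_(i <- r | Q i) F i m.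
Proof. by apply: (big_morph (fun F : fps R => F m)). Qed.

Lemma fps_1E m : (1 : fps R) m = (m == mset0)%:R. Proof. by []. Qed.

Lemma fps_mulr_seq F G m (r : seq (monom * monom)) : uniq r ->
  (forall z, (z \in r) = (msetD z.1 z.2 == m)) -> (F * G) m = \sum_(z <- r) F z.1 * G z.2.
Proof.
move=> ur rE; apply: fsum_seq => // z; first by rewrite rE => /eqP.
by move=> /= zm _; rewrite rE zm.
Qed.

Definition splitting m : seq (monom * monom) :=
  fset_set [set z : monom * monom | msetD z.1 z.2 = m].

Lemma mem_splitting m z : (z \in splitting m) = (msetD z.1 z.2 == m).
Proof.
rewrite /splitting in_fset_set; last exact: splits_finite.
by apply/idP/eqP => [/set_mem //|pm]; apply/mem_set.
Qed.

Lemma splitting_uniq m : uniq (splitting m). Proof. exact: fset_uniq. Qed.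

Lemma fps_mulrE F G m : (F * G) m = \sum_(z <- splitting m) F z.1 * G z.2.
Proof. by apply: fps_mulr_seq (splitting_uniq m) (mem_splitting m). Qed.

Lemma splitting0 : splitting mset0 = [:: (mset0, mset0)].
Proof.
apply: perm_small_eq => //; apply: uniq_perm => // [|[p q]]; first exact: splitting_uniq.
rewrite mem_splitting inE /=; apply/eqP/eqP => [|[-> ->]]; last by rewrite mset0D.
move=> pq0; have /eqP := congr1 (fun A : monom => size A) pq0.
rewrite size_msetD enum_mset0 addn_eq0 => /andP[/eqP p0 /eqP q0].
by rewrite (mset_size0 p0) (mset_size0 q0).
Qed.

Definition coef0 F : R := F mset0.

Fact coef0_is_zmod_morphism : zmod_morphism coef0. Proof. by []. Qed.
Fact coef0_is_monoid_morphism : monoid_morphism coef0.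
Proof.
split; first by rewrite /coef0 fps_1E eqxx.
by move=> F G; rewrite /coef0 fps_mulrE splitting0 big_seq1.
Qed.
HB.instance Definition _ := GRing.isZmodMorphism.Build (fps R) R coef0 coef0_is_zmod_morphism.
HB.instance Definition _ := GRing.isMonoidMorphism.Build (fps R) R coef0 coef0_is_monoid_morphism.

Lemma fps_mulzE (n : int) F m : (n%:~R * F) m = n%:~R * F m.
Proof.
rewrite !mulrzl; case: n => n; rewrite /intmul /=; first by elim: n => // n IH; rewrite !mulrS fps_addE IH.
by rewrite fps_oppE; congr -%R; elim: n.+1 => // k IH; rewrite !mulrS fps_addE IH.
Qed.

(* [res P F] is [F] with every variable outside of [P] set to zero. *)
Definition res P F : fps R := fun m => if all P m then F m else 0.

Lemma resE P F m : all P m -> res P F m = F m. Proof. by rewrite /res => ->. Qed.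

Fact res_is_zmod_morphism P : zmod_morphism (res P).
Proof. by move=> F G; apply/funext => m; rewrite fps_addE fps_oppE /res; case: all; rewrite ?subr0. Qed.

Fact res_is_monoid_morphism P : monoid_morphism (res P).
Proof.
split.
  apply/funext => m; rewrite /res fps_1E; case: eqP => [->|_]; last by case: all.
  by rewrite enum_mset0.
move=> F G; apply/funext => m; rewrite /res !fps_mulrE.
case: ifP => Pm; last first.
  rewrite big_seq big1 // => -[p q]; rewrite mem_splitting /= => /eqP pq.
  move: Pm; rewrite -pq all_msetD; by case: (all P (enum_mset p)) => /= [->|]; rewrite ?mulr0 ?mul0r.
apply: eq_big_seq => -[p q]; rewrite mem_splitting /= => /eqP pq.
by move: Pm; rewrite -pq all_msetD => /andP[-> ->].
Qed.
HB.instance Definition _ P := GRing.isZmodMorphism.Build (fps R) (fps R) (res P) (@res_is_zmod_morphism P).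
HB.instance Definition _ P := GRing.isMonoidMorphism.Build (fps R) (fps R) (res P) (@res_is_monoid_morphism P).

Lemma res_coef0 P F : (forall v, ~~ P v) -> forall m, res P F m = (m == mset0)%:R * coef0 F.
Proof.
move=> P0 m; rewrite /res; have [->|m0] := eqVneq m mset0.
  by rewrite enum_mset0 mul1r.
rewrite mul0r; case: ifP => // Pm; case/eqP: m0; apply: mset_size0.
by case: (enum_mset m) Pm => //= a s; rewrite (negbTE (P0 a)).
Qed.

Local Notation "''x_' v" := (mono R [:: v]) (at level 8, v at level 2, format "''x_' v").

Lemma mono0 : mono R [::] = 1.
Proof.
by apply/funext => m; rewrite /mono fps_1E; congr (_ == _)%:R; apply/msetP => i; rewrite mset_seqE mset0E.
Qed.

Lemma mulrx_mono s F m : (mono R s * F) (msetD (seq_mset s) m) = F m.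
Proof.
rewrite fps_mulrE (bigD1_seq (seq_mset s, m)) ?splitting_uniq //=; last by rewrite mem_splitting.
rewrite /mono eqxx mul1r big_seq_cond big1 ?addr0 // => -[p q] /andP[].
rewrite mem_splitting /=; case: (eqVneq p) => [-> /eqP /msetD_inj ->|_]; rewrite ?eqxx ?mul0r //.
Qed.

Lemma mulrx_mono0 s F m : (forall q, msetD (seq_mset s) q <> m) -> (mono R s * F) m = 0.
Proof.
move=> sm; rewrite fps_mulrE big_seq big1 // => -[p q]; rewrite mem_splitting /mono /=.
by case: (eqVneq p) => [-> /eqP /sm //|]; rewrite mul0r.
Qed.

Lemma mono_cat s t : mono R (s ++ t) = mono R s * mono R t.
Proof.
apply/funext => m; have [[q <-]|no] := pselect (exists q, msetD (seq_mset s) q = m).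
  rewrite mulrx_mono /mono seq_mset_cat; congr ((nat_of_bool _)%:R).
  by apply/eqP/eqP => [/msetD_inj|->].
rewrite mulrx_mono0; last by move=> q E; apply: no; exists q.
rewrite /mono; case: eqP => // E; case: no; exists (seq_mset t).
by rewrite -seq_mset_cat.
Qed.

Lemma mono_perm s t : perm_eq s t -> mono R s = mono R t.
Proof. by move=> /eq_seq_msetP st; apply/funext => m; rewrite /mono st. Qed.

Lemma eq_res P Q F : P =1 Q -> res P F = res Q F.
Proof. by move=> PQ; apply/funext => m; rewrite /res (eq_all PQ). Qed.

Definition addv P (v : nat) : pred nat := [pred i | (i == v) || P i].

(** Only the term linear in [x_v] contributes to a monomial in which [v] occurs exactly once, so [G]
    can be left arbitrary. *)
Lemma coef_fresh P v F F0 F1 G m : ~~ P v -> all P m ->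
  res (addv P v) F = res P F0 + 'x_v * res P F1 + 'x_v ^+ 2 * G ->
  F (msetD (msetn 1 v) m) = F1 m.
Proof.
move=> nPv Pm E; have Pvm : all (addv P v) (msetD (msetn 1 v) m).
  rewrite -mset1_seq all_msetD all_seq_mset; apply/andP; split.
    by rewrite all_seq1; apply/orP; left.
  by apply: sub_all Pm => i Pi; rewrite /addv /= Pi orbT.
have nv : v \notin m by apply: contra nPv => /(allP Pm).
rewrite -(resE F Pvm) E !fps_addE -mset1_seq mulrx_mono (resE F1 Pm).
rewrite /res all_msetD all_seq_mset /= (negbTE nPv) /= add0r.
rewrite expr2 -mono_cat mulrx_mono0 ?addr0 // => q.
move=> /(congr1 (fun A : monom => A v)); rewrite !msetE2 !mset_seqE /= eqxx.
by move/mset_eq0P: nv => ->; lia.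
Qed.

End Coefficients.

(** * Elementary symmetric series *)

Arguments elem : simpl never.
Section Recursions.
Variable R : comNzRingType.
Implicit Types (F G H : fps R) (m p q : monom) (P : pred nat).

Local Notation "''x_' v" := (mono R [:: v]) (at level 8, v at level 2, format "''x_' v").

(** Reduces identities for [fser], an infinite sum, to finite sums, degree by degree. *)
Definition agree (M : nat) F G := forall m, (size m < M)%N -> F m = G m.

Lemma agree_all F G : (forall M, agree M F G) -> F = G.
Proof. by move=> FG; apply/funext => m; apply: (FG (size m).+1). Qed.

Lemma agree_sym M F G : agree M F G -> agree M G F.
Proof. by move=> FG m /FG. Qed.

Lemma agree_trans M F G H : agree M F G -> agree M G H -> agree M F H.
Proof. by move=> FG GH m mM; rewrite FG // GH. Qed.

Lemma agreeD M F F' G G' : agree M F F' -> agree M G G' -> agree M (F + G) (F' + G').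
Proof. by move=> FF GG m mM; rewrite !fps_addE FF ?GG. Qed.

Lemma agreeM M F F' G G' : agree M F F' -> agree M G G' -> agree M (F * G) (F' * G').
Proof.
move=> FF GG m mM; rewrite !fps_mulrE; apply: eq_big_seq => -[p q].
rewrite mem_splitting => /eqP /= pq; move: mM; rewrite -pq size_msetD => mM.
by rewrite FF ?GG //; lia.
Qed.

Lemma agree_res M P F G : agree M F G -> agree M (res P F) (res P G).
Proof. by move=> FG m mM; rewrite /res FG. Qed.

(* The squarefree monomials whose degree satisfies [phi]: [elem] and [esum] are of this form. *)
Definition sqfree (phi : pred nat) : fps R := fun m => (uniq m && phi (size m))%:R.

Lemma mem_mset1D v p (m := msetD (msetn 1 v) p) :
  (all^~ m =1 fun P => P v && all P p) /\ (uniq m = (v \notin p) && uniq p).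
Proof.
have vp : perm_eq m (v :: p).
  by rewrite /m -mset1_seq -{1}[p]seq_mset_id -seq_mset_cat; apply: perm_eq_seq_mset.
by split => [P|]; [rewrite (perm_all _ vp)|rewrite (perm_uniq vp)].
Qed.

Lemma sqfree_rec P v phi : ~~ P v ->
  res (addv P v) (sqfree phi) = res P (sqfree phi) + 'x_v * res P (sqfree (phi \o succn)).
Proof.
move=> nPv; apply/funext => m; rewrite fps_addE.
have addvE p : v \notin p -> all (addv P v) p = all P p.
  move=> vp; apply: eq_in_all => i ip; rewrite /addv /=.
  by case: eqP vp => // <-; rewrite ip.
have [vm|vm] := boolP (v \in m); last first.
  rewrite mulrx_mono0 ?addr0 /res ?addvE // => q qm.
  by move: vm; rewrite -qm mset1_seq in_mset1D eqxx.
rewrite -(msetB1K vm); set p := msetB m _.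
rewrite -mset1_seq mulrx_mono mset1_seq /res /sqfree.
have [allE uniqE] := mem_mset1D v p; rewrite !allE uniqE size_msetD (negbTE nPv) add0r /=.
rewrite -mset1_seq size_seq_mset /= {1}/addv /= eqxx /=.
have [vp|vp] := boolP (v \in p); last by rewrite addvE.
by case: ifP => // _; case: ifP => // /allP /(_ _ vp); rewrite (negbTE nPv).
Qed.

Lemma elemE (n : int) m : elem R n m = (uniq m && (Posz (size m) == n))%:R.
Proof.
case: n => n; last by rewrite andbF.
have sort_mono : mono R (sort leq m) m = 1.
  by rewrite /mono (_ : seq_mset _ = m) ?eqxx // -{2}[m]seq_mset_id; apply/eq_seq_msetP; rewrite perm_sort.
have sortE s : sorted ltn s -> mono R s m != 0 -> s = sort leq m /\ uniq m.
  rewrite ltn_sorted_uniq_leq /mono => /andP[us ss]; case: (eqVneq m) => [->|_]; last by rewrite eqxx.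
  move=> _; split; last by rewrite (perm_uniq (perm_eq_seq_mset s)).
  apply: (sorted_eq leq_trans anti_leq) => //; first exact: sort_sorted leq_total _.
  by rewrite perm_sym perm_sort perm_eq_seq_mset.
rewrite /elem /fsum; have [|nm] := boolP (uniq m && _).
  move=> /andP[um /eqP[sm]]; rewrite (@fsum_seq _ _ _ [:: sort leq m]) ?big_seq1 ?sort_mono //.
    move=> s; rewrite inE => /eqP ->; split; last by rewrite size_sort.
    by rewrite ltn_sorted_uniq_leq sort_uniq um sort_sorted //; exact: leq_total.
  by move=> s [/sortE E _] /E [-> _]; rewrite inE.
rewrite (@fsum_seq _ _ _ [::]) ?big_nil // => s [/sortE E sn] /E [sE um].
by case/negP: nm; rewrite um -sn sE size_sort eqxx.
Qed.

Lemma elem_sqfree n : elem R n = sqfree (fun s => Posz s == n).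
Proof. by apply/funext => m; rewrite elemE. Qed.

Lemma esum_sqfree : esum = sqfree xpredT.
Proof.
apply/funext => m; rewrite /esum /fsum (@fsum_seq _ _ _ [:: size m]) //.
  by rewrite big_seq1 elemE eqxx.
by move=> n _; rewrite elemE inE; case: (eqVneq n) => //; rewrite eqz_nat eq_sym =>
  /negbTE ->; rewrite andbF eqxx.
Qed.

Lemma elem_rec P v n : ~~ P v ->
  res (addv P v) (elem R n) = res P (elem R n) + 'x_v * res P (elem R (n - 1)).
Proof.
move=> nPv; rewrite !elem_sqfree sqfree_rec //; congr (_ + _ * res P _).
by apply/funext => m; rewrite /sqfree /=; congr (_ && _)%:R; apply/eqP/eqP; lia.
Qed.

Lemma esum_rec P v : ~~ P v -> res (addv P v) esum = (1 + 'x_v) * res P (esum : fps R).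
Proof.
move=> nPv; have dl (x F : fps R) : (1 + x) * F = F + x * F by rewrite mulrDl mul1r.
by rewrite dl !esum_sqfree sqfree_rec.
Qed.

Lemma elem_neg n : n < 0 -> elem R n = 0. Proof. by case: n. Qed.

Lemma agree_elem0 M (n : int) : M%:Z <= n -> agree M (elem R n) 0.
Proof. by move=> Mn m mM; rewrite elemE; case: eqP; rewrite ?andbF //; lia. Qed.

Definition ftrunc (M : nat) (d : int) : fps R := \sum_(n < M) elem R n * elem R (n%:Z + d).

(** An omitted term has a factor [elem n] with [n] negative or at least [M], which vanishes below
    degree [M]. *)
Lemma agree_ftrunc M N d : (M <= N)%N -> agree M (fser d) (ftrunc N d).
Proof.
move=> MN m mM; rewrite /fser /fsum /ftrunc fps_sumE.
rewrite (@fsum_seq _ _ _ (map Posz (iota 0 N))) //.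
- by rewrite big_map -(big_mkord xpredT (fun n : nat => (elem R n * elem R (n%:Z + d)) m)) /index_iota subn0.
- by rewrite map_inj_uniq ?iota_uniq // => ? ? [].
move=> n _; apply: contraR => nN; apply/eqP.
case: n nN => [n|n] nN; last by rewrite elem_neg // mul0r.
have -> : 0 = ((0 : fps R) * elem R (n%:Z + d)) m by rewrite mul0r.
apply: (@agreeM M) => //; apply: agree_elem0.
by move: nN; rewrite mem_map ?mem_iota => [|? ? []//]; lia.
Qed.

Lemma fserN d : fser (- d) = fser d :> fps R.
Proof.
apply/funext => m; rewrite /fser /fsum (@reindex_fsbigT _ _ _ _ _ (fun n : int => n + d)).
  by apply: eq_fsbigr => n _; rewrite addrK mulrC.
by exists (fun n => n - d) => n; rewrite ?addrK ?subrK.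
Qed.

(** The index [d] stands for a difference of two column arguments: moving one of them changes [d] by
    one and costs [x_v], moving both restores [d] and costs its square. *)
Definition hop (P : pred nat) v (u : int -> fps R) (d : int) :=
  res P (u d) + 'x_v * res P (u (d - 1) + u (d + 1)) + 'x_v ^+ 2 * res P (u d).

Lemma fser_rec P v d : ~~ P v -> res (addv P v) (fser d) = hop P v fser d.
Proof.
move=> nPv; apply: agree_all => M.
have shift (u : int -> fps R) (w : int -> fps R) N : u (-1) = 0 ->
    \sum_(n < N.+1) u (n%:Z - 1) * w n%:Z = \sum_(n < N) u n%:Z * w (n%:Z + 1).
  move=> u0; rewrite big_ord_recl /= sub0r u0 mul0r add0r; apply: eq_bigr => n _.
  by congr (u _ * w _); rewrite /= /bump /=; lia.
(* One extra term is kept because reindexing the sums in [elem (n - 1)] shortens them by one. *)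
refine (agree_trans (agree_res (addv P v) (agree_ftrunc d (leqnSn M))) _).
have -> : res (addv P v) (ftrunc M.+1 d) =
    res P (ftrunc M.+1 d) + 'x_v * res P (ftrunc M.+1 (d - 1) + ftrunc M (d + 1))
    + 'x_v ^+ 2 * res P (ftrunc M d).
  pose E n := res P (elem R n).
  have E1 : E (-1) = 0 by rewrite /E elem_neg // raddf0.
  rewrite rmorph_sum (eq_bigr (fun n : 'I__ => E n%:Z * E (n%:Z + d) +
      'x_v * (E n%:Z * E (n%:Z + (d - 1)) + E (n%:Z - 1) * E (n%:Z + d)) +
      'x_v ^+ 2 * (E (n%:Z - 1) * E (n%:Z - 1 + d)))); last first.
    move=> n _; rewrite rmorphM /= !elem_rec // -/(E _) -/(E _) -/(E _) -/(E _).
    have -> : n%:Z + (d - 1) = n%:Z + d - 1 by rewrite addrA.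
    have -> : n%:Z - 1 + d = n%:Z + d - 1 by rewrite addrAC.
    by move: 'x_v => x; ring.
  rewrite !big_split /= -!mulr_sumr big_split /=.
  rewrite (shift E (fun n => E (n + d))) // (shift E (fun n => E (n - 1 + d))) //.
  rewrite rmorphD !rmorph_sum; congr (_ + _ * (_ + _) + _ * _); apply: eq_bigr => n _;
    rewrite rmorphM // /E; congr (_ * res P (elem R _)); lia.
by rewrite /hop; repeat apply: agreeD; try apply: agreeM => //; apply: agree_res;
  repeat apply: agreeD; apply: agree_sym; apply: agree_ftrunc.
Qed.

Definition qser (d : int) : fps R :=
  match d with
  | Posz n => \sum_(i < n) (fser i%:Z + fser (i%:Z + 1))
  | Negz n => - \sum_(i < n.+1) (fser i%:Z + fser (i%:Z + 1))
  end.

Lemma qserN d : qser (- d) = - qser d.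
Proof. by case: d => [[|n]|n] //=; rewrite ?big_ord0 ?oppr0 ?opprK. Qed.

Lemma qser0 : qser 0 = 0. Proof. by rewrite /= big_ord0. Qed.

(** The relation extends below zero by reflection, since [fser] is even and [qser] is odd by
    definition. *)
Lemma qserS d : qser (d + 1) = qser d + (fser d + fser (d + 1)).
Proof.
have nat_case n : qser (n%:Z + 1) = qser n%:Z + (fser n%:Z + fser (n%:Z + 1)).
  have -> : qser (n%:Z + 1) = qser n.+1 by congr qser; lia.
  by rewrite [in LHS]/qser big_ord_recr.
case: d => n; first exact: nat_case.
have -> : Negz n = - (n%:Z + 1) by lia.
rewrite opprD addrNK -opprD !qserN nat_case !fserN opprD -addrA [- (_ + _) + _]addrC.
by rewrite [fser _ + fser n]addrC subrr addr0.
Qed.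

(** Induction on [d]: the increments of both sides are governed by [fser_rec], at 0 both vanish by
    oddness, and negative [d] follows from the oddness of [hop]. *)
Lemma qser_rec P v d : ~~ P v -> res (addv P v) (qser d) = hop P v qser d.
Proof.
move=> nPv; have hopN e : hop P v qser (- e) = - hop P v qser e.
  rewrite /hop; have -> : - e - 1 = - (e + 1) by lia.
  have -> : - e + 1 = - (e - 1) by lia.
  rewrite !qserN !rmorphD !rmorphN /=.
  by move: 'x_v (res P _) (res P _) (res P _) => x A B C; ring.
have nat_case (n : nat) : res (addv P v) (qser n) = hop P v qser n.
  elim: n => [|n IH].
    rewrite /hop qser0 !raddf0 sub0r qserN add0r addNr raddf0 !mulr0; ring.
  rewrite -addn1 PoszD qserS !raddfD /= IH !fser_rec // /hop.
  have q1 := qserS (n%:Z - 1); have q2 := qserS (n%:Z + 1); have q3 := qserS n%:Z.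
  rewrite subrK in q1; rewrite !addrK q2 q3 q1 !rmorphD /=.
  by move: 'x_v => x; ring.
case: d => n //; have -> : Negz n = - n.+1%:Z by [].
by rewrite qserN rmorphN hopN -nat_case.
Qed.

Lemma coef0_elem n : coef0 (elem R n) = (n == 0)%:R.
Proof. by rewrite /coef0 elemE enum_mset0 /= eq_sym. Qed.

Lemma coef0_esum : coef0 (esum : fps R) = 1.
Proof. by rewrite esum_sqfree /coef0 /sqfree enum_mset0. Qed.

Lemma coef0_fser d : coef0 (fser d : fps R) = (d == 0)%:R.
Proof.
rewrite /coef0 (agree_ftrunc d (leqnn 1)) ?enum_mset0 // -/(coef0 _) /ftrunc big_ord1.
by rewrite rmorphM /= !coef0_elem eqxx mul1r add0r.
Qed.

(** Among the [fser] summed, only [fser 0] has a nonzero constant term, and it occurs once. *)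
Lemma coef0_qser_gt0 (d : int) : 0 < d -> coef0 (qser d) = 1.
Proof.
case: d => [[|n]|n] // _; elim: n => [|n IH]; rewrite /= ?big_ord1.
  by rewrite raddfD /= !coef0_fser eqxx add0r oner_eq0 addr0.
by rewrite big_ord_recr raddfD /= -/(qser (Posz n.+1)) IH raddfD /= !coef0_fser !addr0 //; ring.
Qed.

Lemma coef0_qser_lt0 (d : int) : d < 0 -> coef0 (qser d) = -1.
Proof. by move=> d0; rewrite -[d]opprK qserN raddfN /= coef0_qser_gt0 //; lia. Qed.

End Recursions.

(** * Symmetric series *)

Lemma bij_mset_map (sigma tau : nat -> nat) (m : monom) : cancel sigma tau ->
  seq_mset (map tau (seq_mset (map sigma m))) = m.
Proof.
move=> st; rewrite -[RHS]seq_mset_id; apply/eq_seq_msetP.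
rewrite -[X in perm_eq _ X](mapK st); apply: perm_map; exact: perm_eq_seq_mset.
Qed.

Lemma mset_mapD (sigma : nat -> nat) (p q : monom) :
  seq_mset (map sigma (msetD p q)) = msetD (seq_mset (map sigma p)) (seq_mset (map sigma q)).
Proof.
rewrite -seq_mset_cat -map_cat; apply/eq_seq_msetP/perm_map.
by rewrite -{1}[p]seq_mset_id -{1}[q]seq_mset_id -seq_mset_cat; apply: perm_eq_seq_mset.
Qed.

Definition swap (a b i : nat) := if i == a then b else if i == b then a else i.

Lemma swap_bij a b : bijective (swap a b).
Proof.
have K : involutive (swap a b); last by exists (swap a b).
move=> i; rewrite /swap; have [->|ia] := eqVneq i a.
  by rewrite eqxx; case: eqVneq.
have [->|ib] := eqVneq i b; first by rewrite eqxx.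
by rewrite (negbTE ia) (negbTE ib).
Qed.

Lemma swap_id a b i : i != a -> i != b -> swap a b i = i.
Proof. by rewrite /swap => /negbTE -> /negbTE ->. Qed.

(** The bijection must be one of all naturals, as in [sym_series]. It is built by following the one
    for the prefix with a transposition that moves the new element into place. *)
Lemma bij_uniq_iota (u : seq nat) : uniq u ->
  exists sigma : nat -> nat, bijective sigma /\ map sigma u = iota 0 (size u).
Proof.
elim/last_ind: u => [|u v IH]; first by exists id; split => //; exists id.
rewrite rcons_uniq => /andP[vu /IH [s [bs us]]].
exists (swap (s v) (size u) \o s); split; first exact: bij_comp (swap_bij _ _) bs.
rewrite map_rcons size_rcons -addn1 iotaD cats1 /= /swap eqxx; congr rcons.
rewrite -us; apply/eq_in_map => i iu /=; rewrite -/(swap _ _ _) swap_id //.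
  by apply: contraNneq vu => /(bij_inj bs) <-.
by apply/eqP => E; have := map_f s iu; rewrite us E mem_iota add0n ltnn.
Qed.

(* The tableau of shape [mu] with all entries of its row [i] equal to [k + i]; for [k = 0] it
   is the only one of its shape and weight. *)
Fixpoint ptab (k : nat) (mu : seq nat) : seq (seq nat) :=
  if mu is a :: mu' then nseq a k :: ptab k.+1 mu' else [::].

Lemma count_ptab k mu i :
  count_mem i (flatten (ptab k mu)) = if (k <= i)%N then nth 0%N mu (i - k) else 0%N.
Proof.
elim: mu k => [|a mu IH] k /=; first by rewrite nth_nil if_same.
rewrite count_cat count_nseq IH /=; case: (ltngtP k i) => [ki|ki|<-] /=.
- by rewrite -(subnSK ki).
- by [].
- by rewrite subnn mul1n addn0.
Qed.

Definition xpart (mu : seq nat) : monom := seq_mset (flatten (ptab 0 mu)).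

(** Renaming the variables in order of decreasing multiplicity turns the exponents into a partition;
    hence a symmetric series is determined by its coefficients at the [xpart mu]. *)
Lemma mono_part (m : monom) :
  exists sigma mu, [/\ bijective sigma, is_part mu & seq_mset (map sigma m) = xpart mu].
Proof.
pose u := sort (fun a b => count_mem b m <= count_mem a m)%N (undup m).
have uE : u =i (m : seq nat) by move=> i; rewrite mem_sort mem_undup.
have [] := @bij_uniq_iota u; first by rewrite sort_uniq undup_uniq.
move=> s [bs us]; exists s, [seq count_mem i m | i <- u]; split => //.
  split; last first.
    apply/negP => /mapP[i]; rewrite uE => im /esym/eqP.
    by rewrite -leqn0 leqNgt -has_count has_pred1 im.
  by rewrite sorted_map; apply: sort_sorted => a b; apply: leq_total.
apply/msetP => i; rewrite !mset_seqE count_ptab subn0 /=.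
have [t st ts] := bs.
have [iu|iu] := ltnP i (size u); last first.
  rewrite nth_default ?size_map //; apply/count_memPn/negP => /mapP[j].
  rewrite -uE => ju E; have := map_f s ju.
  by rewrite us -E mem_iota add0n ltnNge iu.
rewrite (nth_map 0%N) // count_map; apply: eq_count => j /=.
have E : s (nth 0%N u i) = i by rewrite -(nth_map 0%N 0%N) // us nth_iota.
by rewrite -{1}E (inj_eq (bij_inj bs)).
Qed.

Section Symmetric.
Variable R : comNzRingType.
Implicit Types (F G H : fps R) (m p q : monom).

Lemma sym_seriesE F : sym_series F <->
  (forall sigma : nat -> nat, bijective sigma -> forall m : monom, F (seq_mset (map sigma m)) = F m).
Proof.
split=> sF s bs m; first by rewrite sF // seq_mset_id.
rewrite -(sF s bs (seq_mset m)); congr (F _); apply/eq_seq_msetP/perm_map.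
by rewrite perm_sym perm_eq_seq_mset.
Qed.

Lemma sym_xpart F G : sym_series F -> sym_series G ->
  (forall mu, is_part mu -> F (xpart mu) = G (xpart mu)) -> F = G.
Proof.
move=> /sym_seriesE sF /sym_seriesE sG FG; apply/funext => m.
by have [s [mu [bs pmu E]]] := mono_part m; rewrite -(sF _ bs) -(sG _ bs) E FG.
Qed.

Lemma symD F G : sym_series F -> sym_series G -> sym_series (F + G).
Proof. by move=> sF sG s bs m; rewrite !fps_addE sF // sG. Qed.

Lemma symN F : sym_series F -> sym_series (- F).
Proof. by move=> sF s bs m; rewrite !fps_oppE sF. Qed.

Lemma sym1 : sym_series (1 : fps R).
Proof.
move=> s bs m; rewrite !fps_1E; congr ((nat_of_bool _)%:R).
by apply/eqP/eqP => /(congr1 (fun A : monom => size A)); rewrite size_seq_mset enum_mset0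
  ?size_map => /size0nil ->; apply/msetP => i; rewrite mset_seqE mset0E.
Qed.

Lemma symM F G : sym_series F -> sym_series G -> sym_series (F * G).
Proof.
move=> /sym_seriesE sF /sym_seriesE sG; apply/sym_seriesE => s bs m.
have [t st ts] := bs.
pose f (u : nat -> nat) (z : monom * monom) := (seq_mset (map u z.1), seq_mset (map u z.2)) : monom * monom.
have fK u u' : cancel u u' -> cancel (f u) (f u').
  by move=> uu [p q]; rewrite /f /= !bij_mset_map.
rewrite fps_mulrE (perm_big (map (f s) (splitting m))) /=.
  by rewrite big_map fps_mulrE; apply: eq_bigr => z _; rewrite sF // sG.
apply: uniq_perm; rewrite ?splitting_uniq ?(map_inj_uniq (can_inj (fK _ _ st))) ?splitting_uniq //.
move=> z; rewrite -(fK _ _ ts z) (mem_map (can_inj (fK _ _ st))) !mem_splitting /f /=.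
rewrite -!mset_mapD; apply/eqP/eqP; last by move=> ->.
by move=> /(congr1 (fun A : monom => seq_mset (map t A))); rewrite !(bij_mset_map _ st).
Qed.

Lemma sym_sum (I : Type) (r : seq I) (P : pred I) (F : I -> fps R) :
  (forall i, sym_series (F i)) -> sym_series (\sum_(i <- r | P i) F i).
Proof. by move=> sF; elim/big_rec: _ => // i G _; apply: symD. Qed.

Lemma sym_prod (I : Type) (r : seq I) (P : pred I) (F : I -> fps R) :
  (forall i, sym_series (F i)) -> sym_series (\prod_(i <- r | P i) F i).
Proof. by move=> sF; elim/big_rec: _ => [|i G _]; [exact: sym1|apply: symM]. Qed.

Lemma sym_det n (A : 'M[fps R]_n) : (forall i j, sym_series (A i j)) -> sym_series (\det A).
Proof.
move=> sA; apply: sym_sum => s; apply: symM; last exact: sym_prod.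
by case: odd_perm; rewrite ?expr1 ?expr0; [apply: symN|]; exact: sym1.
Qed.

Lemma sym_elem n : sym_series (elem R n).
Proof.
apply/sym_seriesE => s bs m; rewrite !elemE size_seq_mset size_map.
by rewrite (perm_uniq (perm_eq_seq_mset _)) map_inj_uniq //; apply: bij_inj.
Qed.

Lemma sym_fser d : sym_series (fser d : fps R).
Proof.
move=> s bs m; apply: eq_fsbigr => n _.
by apply: symM => //; apply: sym_elem.
Qed.

Definition fresh m : nat := (\max_(i <- m) i).+1.

Lemma fresh_notin m : fresh m \notin m.
Proof.
by apply/negP => /(@leq_bigmax_seq _ (m : seq nat) xpredT id _) /(_ isT); rewrite /fresh ltnn.
Qed.

(* For a symmetric [F], the coefficient of a variable that does not occur in the monomials
   considered; this will turn out to be the skewing by [psum1]. *)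
Definition pskew F : fps R := fun m => F (msetD (msetn 1 (fresh m)) m).

(** The transposition of [fresh m] and [v] fixes every variable of [m]. *)
Lemma pskewE F v m : sym_series F -> v \notin m -> pskew F m = F (msetD (msetn 1 v) m).
Proof.
move=> sF vm; rewrite /pskew -!mset1_seq -{2}[m]seq_mset_id -{3}[m]seq_mset_id -!seq_mset_cat.
rewrite -(sF _ (swap_bij (fresh m) v)) /= /swap eqxx; congr (F (seq_mset (_ :: _))).
apply: map_id_in => i im; rewrite -/(swap _ _ _) swap_id //.
  by apply: contraNneq (fresh_notin m) => <-.
by apply: contraNneq vm => <-.
Qed.

Lemma sym_pskew F : sym_series F -> sym_series (pskew F).
Proof.
move=> sF; apply/sym_seriesE => s bs m.
rewrite (@pskewE F (s (fresh m))) // ?/pskew; last first.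
  by rewrite (perm_mem (perm_eq_seq_mset _)) mem_map ?fresh_notin //; apply: bij_inj.
rewrite -mset1_seq -seq_mset_cat /= -/(map s (fresh m :: m)) sF //.
by rewrite mset_cons seq_mset_id.
Qed.

Lemma pskew_rec F F0 F1 (G : pred nat -> nat -> fps R) :
  (forall P v, ~~ P v -> res (addv P v) F =
     res P F0 + mono R [:: v] * res P F1 + mono R [:: v] ^+ 2 * G P v) ->
  pskew F = F1.
Proof.
move=> E; apply/funext => m; apply: (@coef_fresh _ (mem m) _ _ F0 F1 (G (mem m) (fresh m))).
- exact: fresh_notin.
- by apply/allP => i.
- by apply: E; apply: fresh_notin.
Qed.

Lemma pskew_fser d : pskew (fser d) = fser (d - 1) + fser (d + 1).
Proof. by apply: (@pskew_rec _ (fser d)) => P v nPv; rewrite fser_rec. Qed.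

Lemma pskewD F G : pskew (F + G) = pskew F + pskew G. Proof. by []. Qed.
Lemma pskewN F : pskew (- F) = - pskew F. Proof. by []. Qed.

End Symmetric.

(** * Tableaux as chains of column sets *)

(** The rule for conjugate partitions: whether a cell lies in the diagram can be tested by its row
    length or by its column height. *)
Lemma count_geq (s : seq nat) i j : sorted geq s ->
  (i < count (fun p => j < p) s)%N = (j < nth 0%N s i)%N.
Proof.
elim: s i => [|a s IH] i /=; first by rewrite nth_nil.
move=> pas; have [ja|aj] := ltnP j a; rewrite /=.
  by case: i => [|i] //=; rewrite -IH ?(path_sorted pas).
have /allP as_ : all (geq a) s by apply: order_path_min pas => x y z /= xy yz; apply: leq_trans yz xy.
rewrite add0n; have -> : count (fun p => j < p)%N s = 0%N.
  apply/eqP; rewrite -leqn0 leqNgt -has_count; apply/hasPn => x /as_ /= xa.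
  by rewrite -leqNgt (leq_trans xa).
rewrite ltn0; case: i => [|i] /=; first by rewrite ltnNge aj.
have [is_|si] := ltnP i (size s); last by rewrite nth_default.
by apply/esym/negbTE; rewrite -leqNgt (leq_trans _ aj) //; apply: as_; apply: mem_nth.
Qed.

Lemma count_leq (c : seq nat) i n : sorted leq c -> (i < size c)%N ->
  (nth 0%N c i < n)%N = (i < count (fun x => x < n) c)%N.
Proof.
elim: c i => [|a c IH] i //= pac; have [an|na] := ltnP a n; rewrite /=.
  by case: i => [|i] //= ic; rewrite IH ?(path_sorted pac).
have /allP ca : all (leq a) c by apply: order_path_min pac; apply: leq_trans.
rewrite add0n; have -> : count (fun p => p < n)%N c = 0%N.
  apply/eqP; rewrite -leqn0 leqNgt -has_count; apply/hasPn => x /ca /= ax.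
  by rewrite -leqNgt (leq_trans na).
rewrite ltn0; case: i => [|i] /= ic; first by rewrite ltnNge na.
by apply/negbTE; rewrite -leqNgt (leq_trans na) //; apply: ca; apply: mem_nth.
Qed.

(* A sequence is below another one, and at least as long, iff for each [n] it has at least as
   many terms below [n]: this turns the row condition on tableaux into one on column heights. *)
Lemma below_countP (c d : seq nat) : sorted ltn c -> sorted ltn d ->
  (forall i, (i < size d)%N -> (i < size c)%N /\ (nth 0%N c i <= nth 0%N d i)%N) <->
  (forall n, (count (fun x => x < n) d <= count (fun x => x < n) c)%N).
Proof.
rewrite !ltn_sorted_uniq_leq => /andP[_ sc] /andP[_ sd]; split=> [cd n|cd i id].
  case E: (count (fun x => x < n) d)%N => [//|p].
  have pd : (p < size d)%N by rewrite -E count_size.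
  have [pc cdp] := cd p pd; rewrite -(count_leq n sc pc) (leq_ltn_trans cdp) //.
  by rewrite (count_leq n sd pd) E.
have := cd (nth 0%N d i).+1; have := count_leq (nth 0%N d i).+1 sd id; rewrite ltnSn => /esym id' cdi.
have ic := leq_trans id' cdi; have ic' := leq_trans ic (count_size _ _).
by split=> //; have := count_leq (nth 0%N d i).+1 sc ic'; rewrite ic ltnS.
Qed.

Lemma leq_nthS (s : seq nat) i : sorted geq s -> (nth 0%N s i.+1 <= nth 0%N s i)%N.
Proof.
move=> ss; have [h|h] := ltnP i.+1 (size s); last by rewrite nth_default.
exact: (sortedP 0%N ss).
Qed.

(* The transpose of a sequence of rows: the sequence of its first [k] columns. *)
Definition tr (k : nat) (T : seq (seq nat)) : seq (seq nat) :=
  mkseq (fun j => [seq nth 0%N r j | r <- T & (j < size r)%N]) k.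

(** Row lengths decrease, so the rows that reach column [j] form an initial segment. *)
Lemma filter_colE T j : sorted geq (shape T) ->
  [seq nth 0%N r j | r <- T & (j < size r)%N] =
  mkseq (fun i => nth 0%N (nth [::] T i) j) (count (fun p => j < p)%N (shape T)).
Proof.
elim: T => [|r T IH] //= prT; have [jr|rj] := ltnP j (size r); rewrite /=.
  rewrite IH ?(path_sorted prT) // /mkseq add1n /= -(addn0 1%N) iotaDl -map_comp.
  by congr cons; apply: eq_map.
have c0 i : (j < nth 0%N (size r :: shape T) i)%N = false.
  rewrite -count_geq //= (ltnNge j) rj /=.
  have := @count_geq (size r :: shape T) 0 j prT; rewrite /= (ltnNge j) rj /= add0n.
  by case: count.
have -> : count (fun p => j < p)%N (shape T) = 0%N.
  by have := @count_geq (size r :: shape T) 0 j prT; rewrite c0 /= (ltnNge j) rj /= add0n; case: count.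
rewrite add0n /= (_ : filter _ T = [::]) //; apply/eqP; rewrite -[_ == _]negbK -has_filter.
apply/hasPn => x xT; have : size x \in shape T by apply: map_f.
by move=> /(nthP 0%N)[i _ <-]; have := c0 i.+1 => /= ->.
Qed.

Lemma size_tr k T : size (tr k T) = k. Proof. by rewrite size_mkseq. Qed.

Lemma size_nth_tr k T j : (j < k)%N -> sorted geq (shape T) ->
  size (nth [::] (tr k T) j) = count (fun p => j < p)%N (shape T).
Proof. by move=> jk sT; rewrite nth_mkseq // filter_colE // size_mkseq. Qed.

Lemma nth_tr k T i j : (j < k)%N -> sorted geq (shape T) -> (j < size (nth [::] T i))%N ->
  nth 0%N (nth [::] (tr k T) j) i = nth 0%N (nth [::] T i) j.
Proof.
move=> jk sT jT; rewrite nth_mkseq // filter_colE // nth_mkseq // count_geq //.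
have iT : (i < size T)%N by rewrite ltnNge; apply/negP => /(nth_default [::]) E; rewrite E in jT.
by rewrite (nth_map [::]).
Qed.

Lemma shape_tr k T : sorted geq (shape T) ->
  shape (tr k T) = mkseq (fun j => count (fun p => j < p)%N (shape T)) k.
Proof.
move=> sT; rewrite /shape /tr /mkseq -map_comp; apply: eq_map => j /=.
by rewrite filter_colE // size_mkseq.
Qed.

Lemma sorted_shape_tr k T : sorted geq (shape T) -> sorted geq (shape (tr k T)).
Proof.
move=> sT; rewrite shape_tr //; apply/(sortedP 0%N) => i; rewrite size_mkseq => ik.
rewrite !nth_mkseq ?(ltnW ik) //=; apply: sub_count => x /=; exact: ltnW.
Qed.

Lemma nth_shape (T : seq (seq nat)) i : nth 0%N (shape T) i = size (nth [::] T i).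
Proof.
have [iT|Ti] := ltnP i (size T); first by rewrite (nth_map [::]).
by rewrite !nth_default ?size_map.
Qed.

Lemma leq_head (s : seq nat) i : sorted geq s -> (nth 0%N s i <= head 0 s)%N.
Proof.
case: s => [|a s] /=; first by rewrite nth_nil.
move=> /(order_path_min (fun x y z (yx : x <= y) (yz : z <= x) => leq_trans yz yx))%N /allP as_.
case: i => [|i] //=; have [is_|si] := ltnP i (size s); last by rewrite nth_default.
by apply: as_; apply: mem_nth.
Qed.

Lemma trK k T : sorted geq (shape T) -> (head 0 (shape T) <= k)%N -> tr (size T) (tr k T) = T.
Proof.
move=> sT Tk; have str := sorted_shape_tr k sT.
have rowk i : (size (nth [::] T i) <= k)%N.
  by rewrite -nth_shape; apply: leq_trans Tk; apply: leq_head.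
apply: (@eq_from_nth _ [::]); rewrite size_tr // => i iT.
have sz : size (nth [::] (tr (size T) (tr k T)) i) = size (nth [::] T i).
  rewrite size_nth_tr //.
  have H j : (j < count (fun p => i < p)%N (shape (tr k T)))%N = (j < size (nth [::] T i))%N.
    rewrite count_geq // nth_shape; have [jk|kj] := ltnP j k.
      by rewrite size_nth_tr // count_geq // nth_shape.
    by rewrite nth_default ?size_tr // ltn0; apply/esym/negbTE; rewrite -leqNgt (leq_trans (rowk i)).
  by apply/eqP; rewrite eqn_leq leqNgt H ltnn /= leqNgt -H ltnn.
apply: (@eq_from_nth _ 0%N) => // j; rewrite sz => ji.
have jk := leq_trans ji (rowk i).
rewrite nth_tr // ?nth_tr // size_nth_tr // count_geq // nth_shape //.
Qed.

Lemma perm_flatten_tr k T : {in T, forall r, size r <= k}%N ->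
  perm_eq (flatten (tr k T)) (flatten T).
Proof.
move=> Tk; apply/seq.permP => a; rewrite !count_flatten !sumnE !big_map.
transitivity (\sum_(j <- iota 0 k) \sum_(r <- T) ((j < size r) && a (nth 0%N r j)))%N.
  apply: eq_bigr => j _; rewrite count_map count_filter -sum1_count big_mkcond /=.
  by apply: eq_bigr => r _; rewrite andbC; case: ifP.
rewrite exchange_big /=; apply: eq_big_seq => r /Tk rk.
rewrite -[in count a _](mkseq_nth 0%N r) /mkseq count_map -sum1_count.
have -> : iota 0 k = iota 0 (size r) ++ iota (size r) (k - size r) by rewrite -iotaD subnKC.
rewrite big_cat /= [X in (_ + X)%N]big1_seq ?addn0.
  rewrite [RHS]big_mkcond /=; apply: eq_big_seq => j; rewrite mem_iota /= add0n => -> /=.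
  by case: a.
by move=> j /=; rewrite mem_iota => /andP[rj _]; rewrite ltnNge rj.
Qed.

Section Chains.
Variable k : nat.
Implicit Types (e : {set 'I_k}) (E : seq {set 'I_k}) (T : seq (seq nat)).

(** Membership is extended to all naturals, false from [k] on, so that column heights become
    functions on the naturals that vanish from [k] on. *)
Definition memn e (j : nat) : bool := j \in [seq val i | i in e].

Lemma memnE e (j : 'I_k) : memn e j = (j \in e).
Proof. by rewrite /memn mem_map ?mem_enum //; apply: val_inj. Qed.

Lemma memn_oob e j : (k <= j)%N -> memn e j = false.
Proof. by move=> kj; apply/negbTE/mapP => -[i _ E]; rewrite E leqNgt ltn_ord in kj. Qed.

Definition ht E (j : nat) : nat := count (memn^~ j) E.

Definition dec (h : nat -> nat) : bool := all (fun j => h j.+1 <= h j)%N (iota 0 k).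

(* A chain records a tableau with at most [k] columns one entry at a time: the entry [n] is
   placed in the columns of [nth set0 E n], and the heights of the columns stay decreasing. *)
Fixpoint chains (n : nat) : seq (seq {set 'I_k}) :=
  if n is n'.+1 then
    [seq rcons E e | E <- chains n', e <- [seq e <- enum {set 'I_k} | dec (ht (rcons E e))]]
  else [:: [::]].

Lemma chainsP n E :
  reflect (size E = n /\ forall p, dec (ht (take p E))) (E \in chains n).
Proof.
have dec0 : dec (ht [::]) by apply/allP.
elim: n E => [|n IH] E /=.
  rewrite inE; apply: (iffP eqP) => [->|[/size0nil //]]; by split.
apply: (iffP allpairsPdep) => [[E' [e [/IH[sE' dE']]]]|[]].
  rewrite mem_filter => /andP[de _] ->; rewrite size_rcons sE'; split=> // p.
  have [pn|np] := leqP p (size E'); last by rewrite take_oversize ?size_rcons.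
  by rewrite -cats1 takel_cat.
case/lastP: E => // E e; rewrite size_rcons => -[sE] dE.
exists E, e; split => //.
  apply/IH; split=> // p; have [pn|np] := leqP p (size E).
    by have := dE p; rewrite -cats1 takel_cat.
  by have := dE (size E); rewrite -cats1 take_size_cat // (take_oversize (ltnW np)).
rewrite mem_filter mem_enum andbT; have := dE (size E).+1.
by rewrite take_oversize ?size_rcons.
Qed.

Lemma chains_uniq n : uniq (chains n).
Proof.
elim: n => //= n IH; apply: allpairs_uniq_dep => //.
  by move=> E _; rewrite filter_uniq // enum_uniq.
move=> [E e] [E' e'] _ _ /= /rcons_inj [-> ->] //.
Qed.

Lemma decP (h : nat -> nat) : (forall j, (k <= j)%N -> h j = 0%N) ->
  reflect (forall i j, (i <= j)%N -> (h j <= h i)%N) (dec h).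
Proof.
move=> h0; apply: (iffP allP) => [hd i j ij|hd j _]; last exact: hd.
rewrite -(subnKC ij); elim: (j - i)%N => [|d IH]; first by rewrite addn0.
apply: leq_trans IH; rewrite addnS; have [ik|ki] := ltnP (i + d) k.
  by apply: hd; rewrite mem_iota.
by rewrite h0 // (leq_trans ki).
Qed.

Lemma ht_oob E j : (k <= j)%N -> ht E j = 0%N.
Proof.
move=> kj; apply/eqP; rewrite -leqn0 leqNgt -has_count; apply/hasPn => e _.
by rewrite memn_oob.
Qed.

Lemma ht_cat E E' j : ht (E ++ E') j = (ht E j + ht E' j)%N.
Proof. exact: count_cat. Qed.

Definition cont E : seq nat := flatten (mkseq (fun n => nseq #|nth finset.set0 E n| n) (size E)).

Lemma cont_rcons E e : cont (rcons E e) = cont E ++ nseq #|e| (size E).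
Proof.
rewrite /cont size_rcons mkseqS -cats1 flatten_cat /= cats0 nth_rcons ltnn eqxx; congr (_ ++ _).
congr flatten; apply/eq_in_map => n; rewrite mem_iota add0n /= => nE.
by rewrite nth_rcons nE.
Qed.

Definition col E (j : nat) : seq nat := [seq n <- iota 0 (size E) | memn (nth finset.set0 E n) j].

Lemma col_sorted E j : sorted ltn (col E j).
Proof. by apply: sorted_filter; [exact: ltn_trans|exact: iota_ltn_sorted]. Qed.

Lemma mem_col E j n : (n \in col E j) = (n < size E)%N && memn (nth finset.set0 E n) j.
Proof. by rewrite mem_filter mem_iota add0n andbC. Qed.

(** Through [below_countP], this makes decreasing heights at all times equivalent to weakly
    increasing rows. *)
Lemma count_col E j n : count (fun x => x < n)%N (col E j) = ht (take n E) j.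
Proof.
elim/last_ind: E => [|E e IH]; first by [].
rewrite /col size_rcons -addn1 iotaD filter_cat count_cat /= add0n nth_rcons ltnn eqxx.
have -> : [seq n0 <- iota 0 (size E) | memn (nth finset.set0 (rcons E e) n0) j] = col E j.
  apply: eq_in_filter => x; rewrite mem_iota add0n => /= xE; by rewrite nth_rcons xE.
rewrite IH -cats1; have [nE|En] := leqP n (size E).
  rewrite takel_cat //; case: ifP => _ /=; rewrite ?addn0 // ltnNge nE addn0 //.
rewrite take_oversize ?(ltnW En) // take_oversize ?size_cat ?addn1 // ht_cat /ht /= addn0.
by case: ifP => _ /=; rewrite ?En.
Qed.

Lemma size_col E j : size (col E j) = ht E j.
Proof.
rewrite -{2}(take_size E) -count_col; apply/esym/eqP; rewrite -all_count.
by apply/allP => n; rewrite mem_col => /andP[].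
Qed.

Definition cols E := mkseq (col E) k.

(** A chain yields columns, whereas tableaux are sequences of rows; the number of rows is the height
    of column 0. *)
Definition tab E := tr (ht E 0) (cols E).

Definition untab N T : seq {set 'I_k} :=
  mkseq (fun n => [set j : 'I_k | n \in nth [::] (tr k T) j]%SET) N.

Lemma shape_cols E : shape (cols E) = mkseq (ht E) k.
Proof. by rewrite /shape /cols /mkseq -map_comp; apply: eq_map => j /=; rewrite size_col. Qed.

Lemma nth_cols E j : nth [::] (cols E) j = col E j.
Proof.
have [jk|kj] := ltnP j k; first by rewrite nth_mkseq.
by rewrite nth_default ?size_mkseq //; apply/esym/size0nil; rewrite size_col ht_oob.
Qed.

Definition chain E := forall p, dec (ht (take p E)).

Lemma chain_dec E : chain E -> forall i j, (i <= j)%N -> (ht E j <= ht E i)%N.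
Proof. by move=> /(_ (size E)); rewrite take_size => /decP H; apply: H => j; apply: ht_oob. Qed.

Lemma sorted_cols E : chain E -> sorted geq (shape (cols E)).
Proof.
move=> cE; rewrite shape_cols; apply/(sortedP 0%N) => i; rewrite size_mkseq => ik.
by rewrite !nth_mkseq ?(ltnW ik) //=; apply: chain_dec.
Qed.

Lemma head_cols E : head 0%N (shape (cols E)) = ht E 0.
Proof. by rewrite -nth0 nth_shape nth_cols size_col. Qed.

Lemma tr_tab E : chain E -> tr k (tab E) = cols E.
Proof.
by move=> cE; rewrite -[RHS](@trK (ht E 0) (cols E)) ?sorted_cols ?head_cols // size_mkseq.
Qed.

Lemma untab_tab E : chain E -> untab (size E) (tab E) = E.
Proof.
move=> cE; apply: (@eq_from_nth _ finset.set0); rewrite size_mkseq // => n nE.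
rewrite nth_mkseq //; apply/setP => j; rewrite finset.inE tr_tab // nth_cols mem_col nE.
by rewrite memnE.
Qed.

Lemma ht_shape_tab E j : chain E -> ht E j = count (fun p => j < p)%N (shape (tab E)).
Proof.
move=> cE; have [jk|kj] := ltnP j k.
  by rewrite -size_col -nth_cols -(tr_tab cE) size_nth_tr //; apply: sorted_shape_tr; apply: sorted_cols.
rewrite ht_oob // /tab shape_tr ?sorted_cols //; apply/esym/eqP.
rewrite -leqn0 leqNgt -has_count; apply/hasPn => p /mapP[i _ ->]; rewrite -leqNgt.
by apply: leq_trans (count_size _ _) _; rewrite shape_cols size_mkseq.
Qed.

Lemma size_row_tab E i j : chain E ->
  (j < size (nth [::] (tab E) i))%N = (i < ht E j)%N.
Proof.
move=> cE; rewrite ht_shape_tab // count_geq ?nth_shape //.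
by apply: sorted_shape_tr; apply: sorted_cols.
Qed.

Lemma nth_tab E i j : chain E -> (i < ht E j)%N ->
  nth 0%N (nth [::] (tab E) i) j = nth 0%N (col E j) i.
Proof.
move=> cE ij; rewrite nth_tr ?nth_cols ?size_col ?sorted_cols //.
by apply: leq_trans ij _; apply: chain_dec.
Qed.

Lemma part_tab E : chain E -> is_part (shape (tab E)).
Proof.
move=> cE; split; first by apply: sorted_shape_tr; apply: sorted_cols.
rewrite shape_tr ?sorted_cols //; apply/negP => /mapP[i]; rewrite mem_iota add0n => /= iE.
by apply/eqP; rewrite eq_sym -lt0n count_geq ?sorted_cols // nth_shape nth_cols size_col.
Qed.

Lemma head_tab E : chain E -> (head 0%N (shape (tab E)) <= k)%N.
Proof.
move=> cE; rewrite -nth0 nth_shape leqNgt size_row_tab // ht_oob //.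
Qed.

Lemma ssyt_tab E : chain E -> is_ssyt (shape (tab E)) (tab E).
Proof.
move=> cE; split=> // [i|i j].
  apply/(sortedP 0%N) => j ij; have ij' := ltnW ij.
  rewrite size_row_tab // in ij; rewrite size_row_tab // in ij'.
  rewrite !nth_tab //; have [_ below] := below_countP (col_sorted E j) (col_sorted E j.+1).
  have /below H n : (count (fun x => x < n) (col E j.+1) <= count (fun x => x < n) (col E j))%N.
    by rewrite !count_col; have /decP -> := cE n => // p; apply: ht_oob.
  by have [] := H i; rewrite size_col.
rewrite nth_shape size_row_tab // => ij; rewrite !nth_tab ?(ltnW ij) //.
by apply: (sorted_ltn_nth ltn_trans 0%N (col_sorted E j)) => //; rewrite inE size_col ?(ltnW ij).
Qed.

Lemma sum_memn e : (\sum_(j <- iota 0 k) memn e j)%N = #|e|.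
Proof.
rewrite -sum1_card [RHS]big_mkcond /= -[iota 0 k](val_enum_ord) big_map big_enum /=.
by apply: eq_bigr => j _; rewrite memnE; case: ifP.
Qed.

Lemma perm_tab_cont E : chain E -> perm_eq (flatten (tab E)) (cont E).
Proof.
move=> cE; apply: perm_trans (perm_flatten_tr _) _.
  by move=> r /mapP[j _ ->]; rewrite size_col; apply: chain_dec.
apply/seq.permP => a; rewrite !count_flatten !sumnE !big_map.
transitivity (\sum_(j <- iota 0 k) \sum_(n <- iota 0 (size E))
    memn (nth finset.set0 E n) j * a n)%N.
  apply: eq_bigr => j _; rewrite count_filter -sum1_count big_mkcond /=.
  by apply: eq_bigr => n _; case: (a n); case: memn.
rewrite exchange_big /=; apply: eq_bigr => n _.
by rewrite count_nseq -big_distrl /= sum_memn mulnC.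
Qed.

Section Untab.
Variables (N : nat) (T : seq (seq nat)).
Hypotheses (partT : is_part (shape T)) (ssytT : is_ssyt (shape T) T).
Hypotheses (Tk : (head 0%N (shape T) <= k)%N) (TN : all (fun x => x < N)%N (flatten T)).

Lemma size_row_le i : (size (nth [::] T i) <= k)%N.
Proof. by rewrite -nth_shape; apply: leq_trans Tk; apply: leq_head; case: partT. Qed.

Lemma sorted_tr j : sorted ltn (nth [::] (tr k T) j).
Proof.
have [sT _] := partT; have [_ _ colT] := ssytT.
have [jk|kj] := ltnP j k; last by rewrite nth_default ?size_tr.
apply/(sortedP 0%N) => i; rewrite size_nth_tr // count_geq // => ij.
have ij' : (j < nth 0%N (shape T) i)%N by apply: leq_trans ij _; apply: leq_nthS.
rewrite !nth_tr // -?nth_shape //; exact: colT.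
Qed.

Lemma mem_tr j x : x \in nth [::] (tr k T) j -> (x < N)%N.
Proof.
have [jk|kj] := ltnP j k; last by rewrite nth_default ?size_tr.
move=> xj; apply: (allP TN).
have Tk' : {in T, forall r, size r <= k}%N.
  by move=> r /(nthP [::])[i _ <-]; apply: size_row_le.
rewrite -(perm_mem (perm_flatten_tr Tk')); apply/flattenP; exists (nth [::] (tr k T) j) => //.
by apply: mem_nth; rewrite size_tr.
Qed.

(** Both sides are strictly increasing, so equality of the underlying sets suffices. *)
Lemma col_untab j : col (untab N T) j = nth [::] (tr k T) j.
Proof.
apply: (irr_sorted_eq ltn_trans ltnn); [exact: col_sorted|exact: sorted_tr|].
move=> x; rewrite mem_col size_mkseq; have [jk|kj] := ltnP j k; last first.
  by rewrite memn_oob // andbF nth_default ?size_tr.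
have -> : j = Ordinal jk by []; rewrite memnE.
apply/andP/idP => [[xN]|xj]; first by rewrite nth_mkseq // finset.inE.
by have xN := mem_tr xj; rewrite nth_mkseq // finset.inE.
Qed.

Lemma cols_untab : cols (untab N T) = tr k T.
Proof.
apply: (@eq_from_nth _ [::]); rewrite !size_mkseq // => j jk.
by rewrite nth_cols col_untab.
Qed.

Lemma tab_untab : tab (untab N T) = T.
Proof.
have [sT T0] := partT.
rewrite /tab cols_untab -{3}(trK sT Tk); congr tr.
rewrite -size_col col_untab; have [k0|k0] := posnP k.
  (* Without columns there is no column 0 to give the number of rows; here [T] is empty, as a
     partition has no zero part. *)
  rewrite nth_default ?size_tr ?k0 //; move: Tk T0; rewrite k0.
  by case: (T) => //= r T' r0; rewrite inE eq_sym -leqn0 r0.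
rewrite size_nth_tr // -(size_map size T); apply/eqP; rewrite -all_count.
by apply/allP => p pT; rewrite lt0n; apply: contraNneq T0 => <-.
Qed.

Lemma chain_untab : chain (untab N T).
Proof.
have [sT _] := partT; have [_ rowT _] := ssytT.
move=> p; apply/decP => [j|i j ij]; first exact: ht_oob.
rewrite -!count_col !col_untab; move: p; apply/below_countP; try exact: sorted_tr.
move=> q; have [jk|kj] := ltnP j k; last by rewrite nth_default ?size_tr.
have ik := leq_ltn_trans ij jk; rewrite !size_nth_tr // !count_geq // => qj.
have qi := leq_ltn_trans ij qj; split=> //.
rewrite !nth_tr -?nth_shape //.
by apply: (sorted_leq_nth leq_trans leqnn 0%N (rowT q)) => //; rewrite inE -nth_shape.
Qed.

End Untab.

Lemma mem_tabs N T : T \in map tab (chains N) <->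
  [/\ is_part (shape T), is_ssyt (shape T) T, (head 0 (shape T) <= k)%N
    & all (fun x => x < N)%N (flatten T)].
Proof.
split=> [/mapP[E /chainsP[sE cE] ->]|[pT sT Tk TN]].
  split; [exact: part_tab|exact: ssyt_tab|exact: head_tab|].
  rewrite (perm_all _ (perm_tab_cont cE)); apply/allP => x /flattenP[c /mapP[n]].
  by rewrite mem_iota -sE => /= nE -> /nseqP[-> _].
rewrite -(tab_untab pT sT Tk TN); apply: map_f; apply/chainsP.
by rewrite size_mkseq; split=> //; apply: chain_untab.
Qed.

Lemma tabs_uniq N : uniq (map tab (chains N)).
Proof.
rewrite map_inj_in_uniq ?chains_uniq // => E E' /chainsP[sE cE] /chainsP[sE' cE'] EE.
by rewrite -(untab_tab cE) -(untab_tab cE') EE sE sE'.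
Qed.

(** A tableau with an entry at least [N] cannot have weight [m]; the remaining ones of shape [la]
    correspond to chains of length [N]. *)
Lemma schurE (R : comNzRingType) N la (m : monom) : is_part la -> (head 0 la <= k)%N ->
  all (fun x => x < N)%N m ->
  schur la m = \sum_(E <- chains N | shape (tab E) == la) mono R (cont E) m.
Proof.
move=> pla lak mN; rewrite /schur /fsum.
rewrite (@fsum_seq _ _ _ [seq T <- map tab (chains N) | shape T == la]).
- rewrite big_filter big_map [LHS]big_mkcond [RHS]big_mkcond.
  apply: eq_big_seq => E /chainsP[_ cE].
  by rewrite (mono_perm R (perm_tab_cont cE)).
- by rewrite filter_uniq // tabs_uniq.
- by move=> T; rewrite mem_filter => /andP[/eqP <- /mem_tabs[]].
move=> T sT; rewrite /mono; case: (eqVneq m) => [mT _|_]; last by rewrite eqxx.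
have [sh _ _] := sT; rewrite mem_filter sh eqxx; apply/mem_tabs; rewrite sh; split=> //.
by move: mN; rewrite mT all_seq_mset.
Qed.

Lemma part_tabs_schur (R : comNzRingType) N (m : monom) : all (fun x => x < N)%N m ->
  fsum [set la | is_part la /\ (head 0 la <= k)%N] schur m
  = \sum_(E <- chains N) mono R (cont E) m.
Proof.
move=> mN; rewrite /fsum (@fsum_seq _ _ _ (undup [seq shape (tab E) | E <- chains N])).
- rewrite [LHS](eq_big_seq (fun la => \sum_(E <- chains N | shape (tab E) == la) mono R (cont E) m)).
    rewrite (exchange_big_dep xpredT) //=; apply: eq_big_seq => E EN.
    rewrite -big_filter (_ : filter _ _ = [:: shape (tab E)]) ?big_seq1 //.
    apply: perm_small_eq => //; apply: uniq_perm; rewrite ?filter_uniq ?undup_uniq //.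
    move=> la; rewrite mem_filter inE mem_undup eq_sym; case: eqP => //= ->.
    exact: map_f.
  move=> la; rewrite mem_undup => /mapP[E /chainsP[_ cE] ->].
  by apply: schurE => //; [exact: part_tab|exact: head_tab].
- exact: undup_uniq.
- by move=> la; rewrite mem_undup => /mapP[E /chainsP[_ cE] ->]; split; [exact: part_tab|exact: head_tab].
move=> la [pla lak]; rewrite (schurE _ pla lak mN) mem_undup; apply: contraR => nla.
apply/eqP; rewrite big_mkcond big1_seq // => E /andP[_ EN]; case: eqP => // sE.
by case/negP: nla; rewrite -sE; apply: map_f.
Qed.

End Chains.

(** * Alternating sums and the dual Jacobi-Trudi formula *)

(** An increasing permutation satisfies [i <= s i], and so does its inverse. *)
Lemma sorted_perm_id k (s : 'S_k) : {homo s : i j / (i < j)%N} -> s = perm_one _.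
Proof.
move=> sh; have ge_id (u : 'S_k) : {homo u : i j / (i < j)%N} -> forall i : 'I_k, (i <= u i)%N.
  move=> uh [n nk] /=; elim: n nk => // n IH nk.
  have nk' := ltnW nk; apply: leq_ltn_trans (IH nk') _.
  exact: (uh (Ordinal nk') (Ordinal nk)).
have sVh : {homo (perm_inv s) : i j / (i < j)%N}.
  move=> i j ij; rewrite ltnNge; apply/negP; rewrite leq_eqVlt => /orP[/eqP/val_inj/perm_inj E|].
    by rewrite E ltnn in ij.
  by move=> /sh; rewrite !permKV ltnNge (ltnW ij).
apply/permP => i; rewrite perm1; apply/val_inj/eqP; rewrite eqn_leq ge_id // andbT.
by have := ge_id _ sVh (s i); rewrite permK.
Qed.

Section Alternation.
Variables (R : comNzRingType) (k : nat).
Implicit Types (t : ('I_k -> int) -> fps R) (a b : 'I_k -> int) (e : {set 'I_k}).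

Local Notation "''x_' v" := (mono R [:: v]) (at level 8, v at level 2, format "''x_' v").

Definition bump_on a e : 'I_k -> int := fun i => a i + (i \in e)%:Z.

Definition stepper t := forall (P : pred nat) v a, ~~ P v ->
  res (addv P v) (t a) = \sum_(e : {set 'I_k}) 'x_v ^+ #|e| * res P (t (bump_on a e)).

Definition Alt t a : fps R := \sum_(s : 'S_k) (-1) ^+ s * t (a \o s).

Lemma Alt_eq0 t a i j : i != j -> a i = a j -> Alt t a = 0.
Proof.
move=> ij aij; rewrite /Alt (bigID (@odd_perm _)) /= addrC.
apply/eqP; rewrite addr_eq0 -sumrN; apply/eqP.
rewrite (reindex_inj (mulIg (tperm i j))) /=; apply: eq_big => s.
  by rewrite odd_permM odd_tperm ij addbT negbK.
rewrite odd_permM odd_tperm ij addbT => /negbNE ->; rewrite expr0 expr1 mul1r mulN1r opprK.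
congr t; apply/funext => x /=; rewrite permM.
by case: tpermP => // ->.
Qed.

Lemma Alt_stepper t : stepper t -> stepper (Alt t).
Proof.
move=> st P v a nPv; rewrite /Alt rmorph_sum.
transitivity (\sum_(s : 'S_k) \sum_(e : {set 'I_k})
   'x_v ^+ #|e| * ((-1) ^+ s * res P (t (bump_on a e \o s)))).
  apply: eq_bigr => s _; rewrite rmorphM rmorph_sign /= st // mulr_sumr.
  (* Moving the permuted argument along the preimage of [e] amounts to permuting the argument moved
     along [e], and the two sets have equal cardinality. *)
  rewrite (reindex_inj (h := fun e => s @^-1: e)%SET) /=; last first.
    move=> e e' /setP ee; apply/setP => i; have := ee (perm_inv s i).
    by rewrite !finset.inE permKV.
  apply: eq_bigr => e _; rewrite card_preimset; last exact: perm_inj.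
  rewrite mulrCA; congr (_ * (_ * res P (t _))); apply/funext => i.
  by rewrite /bump_on /= finset.inE.
rewrite exchange_big /=; apply: eq_bigr => e _; rewrite -mulr_sumr; congr (_ * _).
by rewrite rmorph_sum; apply: eq_bigr => s _; rewrite rmorphM rmorph_sign.
Qed.

(** Subtracting the staircase makes weakly decreasing heights strictly decreasing; neighbouring
    arguments collide exactly when a column becomes one higher than its left neighbour. *)
Definition heights (h : nat -> nat) : 'I_k -> int := fun i => (h i)%:Z - i%:Z.

Lemma mono_nseq c v : mono R (nseq c v) = 'x_v ^+ c.
Proof. by elim: c => [|c IH]; rewrite ?mono0 // exprS -IH -mono_cat. Qed.

(* A step that does not leave the heights decreasing makes two arguments of the alternating
   sum equal, so only chains contribute. *)
Lemma Alt_expand t N n : stepper t -> (n <= N)%N ->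
  res [pred i | (i < N)%N] (Alt t (heights (fun _ => 0%N))) =
  \sum_(E <- chains k n) mono R (cont E) *
     res [pred i | (n <= i)%N && (i < N)%N] (Alt t (heights (ht E))).
Proof.
move=> st; elim: n => [|n IH] nN; first by rewrite /= big_seq1 /= mono0 mul1r.
rewrite IH ?(ltnW nN) // {IH} /= big_allpairs_dep; apply: eq_big_seq => E /chainsP[sE cE].
rewrite (@eq_res _ _ (addv [pred i | (n.+1 <= i)%N && (i < N)%N] n)); last first.
  by move=> i; rewrite /addv /= ; case: (ltngtP n i) => //= <-.
rewrite (Alt_stepper st); last by rewrite /= ltnn.
rewrite [LHS]mulr_sumr [RHS]big_filter [RHS]big_mkcond [RHS]big_enum /=; apply: eq_bigr => e _.
have htE i : ht (rcons E e) i = (ht E i + memn e i)%N by rewrite -cats1 ht_cat /ht /= addn0.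
case: ifP => [_|/allPn[j jk]].
  rewrite cont_rcons mono_cat mono_nseq sE -mulrA; congr (_ * (_ * res _ (Alt t _))).
  by apply/funext => i; rewrite /heights /bump_on htE memnE PoszD addrAC.
rewrite -ltnNge !htE => jlt.
have dE : (ht E j.+1 <= ht E j)%N by apply: chain_dec.
have ej1 : memn e j.+1 by case: (memn e j.+1) jlt => //; lia.
have ej : memn e j = false by rewrite ej1 in jlt; case: (memn e j) jlt => //; lia.
have jk1 : (j.+1 < k)%N by rewrite ltnNge; apply: contraTN ej1 => /memn_oob ->.
rewrite (@Alt_eq0 _ _ (Ordinal (ltnW jk1)) (Ordinal jk1)) ?rmorph0 ?mulr0 //.
  by rewrite -val_eqE /= ltn_eqF.
rewrite /bump_on /heights -!memnE /= ej ej1; rewrite ej ej1 in jlt; lia.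
Qed.

Lemma mono_mul_res0 s (F : fps R) (P : pred nat) m : (forall v, ~~ P v) ->
  (mono R s * res P F) m = mono R s m * coef0 F.
Proof.
move=> P0; have [[q <-]|no] := pselect (exists q, msetD (seq_mset s) q = m).
  rewrite mulrx_mono res_coef0 // /mono; congr ((nat_of_bool _)%:R * _).
  apply/eqP/eqP => [->|]; first by rewrite msetD0.
  by rewrite -[X in _ = X]msetD0 => /msetD_inj.
rewrite mulrx_mono0; last by move=> q E; apply: no; exists q.
rewrite /mono; case: (eqVneq m) => [E|_]; last by rewrite mul0r.
by case: no; exists mset0; rewrite msetD0.
Qed.

(** Once the variables below [N] are removed none is left, so each chain is weighted by a mere
    constant term. *)
Lemma Alt_coef t N (m : monom) : stepper t -> all (fun x => x < N)%N m ->
  Alt t (heights (fun _ => 0%N)) m =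
  \sum_(E <- chains k N) mono R (cont E) m * coef0 (Alt t (heights (ht E))).
Proof.
move=> st mN; rewrite -(@resE _ [pred i | (i < N)%N]) // (Alt_expand st (leqnn N)) fps_sumE.
apply: eq_bigr => E _; apply: mono_mul_res0 => v /=.
by rewrite ltnNge andbN.
Qed.

Definition eprod b a : fps R := \prod_i elem R (b i - a i).

Lemma eprod_stepper b : stepper (eprod b).
Proof.
move=> P v a nPv; rewrite /eprod rmorph_prod.
under eq_bigr do rewrite /= elem_rec // addrC.
rewrite bigA_distr /=; apply: eq_bigr => e _.
rewrite rmorph_prod -prodr_const [X in _ = X * _]big_mkcond -big_split /=.
apply: eq_bigr => i _; rewrite /bump_on; case: ifP => _ /=; last by rewrite addr0 mul1r.
by rewrite opprD addrA.
Qed.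

Definition decreasing a := forall i j : 'I_k, (i < j)%N -> a j < a i.

Lemma heights_decreasing (h : nat -> nat) : (forall i j, (i <= j)%N -> (h j <= h i)%N) ->
  decreasing (heights h).
Proof. by move=> hd i j ij; have := hd _ _ (ltnW ij); rewrite /heights; lia. Qed.

(** The constant term of [elem n] is nonzero only for [n = 0], so a permutation contributes only if
    it carries [a] to [b]; as both decrease, it is the identity. *)
Lemma coef0_Alt_eprod a b : decreasing a -> decreasing b ->
  coef0 (Alt (eprod b) a) = [forall i, a i == b i]%:R.
Proof.
move=> da db; rewrite rmorph_sum (bigD1 (perm_one _)) //= odd_perm1 expr0 mul1r.
rewrite [X in _ + X]big1 ?addr0 => [|s s1].
  rewrite rmorph_prod; case: (boolP [forall i, _]) => [/forallP ab|/forallPn[i abi]].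
    by rewrite big1 // => i _; rewrite /= coef0_elem perm1 (eqP (ab i)) subrr eqxx.
  by rewrite (bigD1 i) //= coef0_elem perm1 subr_eq0 eq_sym (negbTE abi) mul0r.
rewrite rmorphM rmorph_prod /=.
have [sh|] := pselect (forall i, b i = a (s i)).
  case/eqP: s1; apply: sorted_perm_id => i j /db; rewrite !sh.
  case: (ltngtP (s i) (s j)) => [//|/da|/val_inj ->]; last by rewrite ltxx.
  by move=> h1 h2; have := lt_trans h1 h2; rewrite ltxx.
move=> /existsNP[i /eqP bi]; rewrite (bigD1 i) //= coef0_elem subr_eq0 (negbTE bi).
by rewrite mul0r mulr0.
Qed.

(* The determinant of the dual Jacobi-Trudi formula, for column lengths [h]. *)
Definition JT (h : 'I_k -> int) : fps R := \det (\matrix_(i, j) elem R (h i - i%:Z + j%:Z)).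

Lemma JT_Alt (h : 'I_k -> int) :
  JT h = Alt (eprod (fun i => h i - i%:Z)) (heights (fun _ => 0%N)).
Proof.
apply: eq_bigr => s _; congr (_ * _); apply: eq_bigr => i _; rewrite mxE /heights /=.
by congr (elem R _); rewrite sub0r opprK.
Qed.

End Alternation.

Definition conj (la : seq nat) (j : nat) : nat := count (fun p => j < p)%N la.

Lemma conj_dec la i j : (i <= j)%N -> (conj la j <= conj la i)%N.
Proof. by move=> ij; apply: sub_count => p /=; apply: leq_ltn_trans. Qed.

Lemma part_nth_inj la mu : is_part la -> is_part mu ->
  (forall i, nth 0%N la i = nth 0%N mu i) -> la = mu.
Proof.
move=> [_ la0] [_ mu0] nthE.
have sizeE (nu : seq nat) i : 0%N \notin nu -> (i < size nu)%N = (0 < nth 0%N nu i)%N.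
  move=> nu0; have [inu|nui] := ltnP i (size nu); last by rewrite nth_default.
  by rewrite lt0n; apply/esym; apply: contraNneq nu0 => <-; apply: mem_nth.
apply: (@eq_from_nth _ 0%N) => [|i _]; last exact: nthE.
have H i : (i < size la)%N = (i < size mu)%N by rewrite !sizeE // nthE.
by apply/eqP; rewrite eqn_leq leqNgt H ltnn /= leqNgt -H ltnn.
Qed.

Lemma conj_inj la mu : is_part la -> is_part mu -> conj la =1 conj mu -> la = mu.
Proof.
move=> pla pmu lamu; have [[sla _] [smu _]] := (pla, pmu).
have nthE i : nth 0%N la i = nth 0%N mu i.
  have H j : (j < nth 0%N la i)%N = (j < nth 0%N mu i)%N.
    by rewrite -!count_geq // -/(conj la j) lamu.
  by apply/eqP; rewrite eqn_leq leqNgt H ltnn /= leqNgt -H ltnn.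
exact: part_nth_inj.
Qed.

Lemma all_fresh (m : monom) : all (fun x => x < fresh m)%N m.
Proof. by apply/allP => i im; rewrite ltnS; exact: (@leq_bigmax_seq _ (m : seq nat) xpredT id i im isT). Qed.

(** The weight of a chain in [Alt_coef] is here the indicator that its column heights are those of
    [la], that is, that its tableau has shape [la]. The freedom in [k] serves the Pieri rules. *)
Lemma schur_JT (R : comNzRingType) k la : is_part la -> (head 0%N la <= k)%N ->
  schur la = JT R (fun i : 'I_k => (conj la i)%:Z).
Proof.
move=> pla lak; apply/funext => m.
rewrite (schurE R pla lak (all_fresh m)) JT_Alt (Alt_coef (@eprod_stepper _ _ _) (all_fresh m)).
rewrite [LHS]big_mkcond; apply: eq_big_seq => E /chainsP[_ cE].
rewrite coef0_Alt_eprod; last 2 first.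
- exact: (heights_decreasing (chain_dec cE)).
- exact: (heights_decreasing (@conj_dec la)).
have -> : [forall i : 'I_k, heights (ht E) i == (conj la i)%:Z - i%:Z] = (shape (tab E) == la).
  apply/forallP/eqP => [ht_conj|sh i]; last by rewrite /heights ht_shape_tab // sh.
  apply: conj_inj => // [|j]; first exact: part_tab.
  rewrite {1}/conj -ht_shape_tab //; have [jk|kj] := ltnP j k.
    by have := ht_conj (Ordinal jk); rewrite /heights => /eqP /=; lia.
  rewrite ht_oob //; apply/esym/eqP; rewrite -leqn0 leqNgt count_geq ?(proj1 pla) // nth0.
  by rewrite -leqNgt (leq_trans lak).
by case: ifP; rewrite ?mulr1 ?mulr0.
Qed.

(** * The Schur basis *)

Lemma shape_ptab k mu : shape (ptab k mu) = mu.
Proof. by elim: mu k => [|a mu IH] k //=; rewrite size_nseq IH. Qed.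

Lemma nth_ptab k mu i : nth [::] (ptab k mu) i = nseq (nth 0%N mu i) (k + i)%N.
Proof.
by elim: mu k i => [|a mu IH] k [|i] //=; rewrite ?IH ?addSnnS ?addn0.
Qed.

Lemma ssyt_ptab mu : is_part mu -> is_ssyt mu (ptab 0 mu).
Proof.
move=> [smu _]; split=> [|i|i j ij]; first exact: shape_ptab.
  by rewrite nth_ptab; elim: (nth 0%N mu i) => //= -[|n] //= ->; rewrite leqnn.
by rewrite !nth_ptab !nth_nseq ij (leq_trans ij (leq_nthS i smu)).
Qed.

Lemma leq_sumn_nseq k (r : seq nat) : all (leq k) r ->
  (size r * k <= sumn r)%N /\ ((sumn r <= size r * k)%N -> r = nseq (size r) k).
Proof.
elim: r => //= a r IH /andP[ka /IH[le_r eq_r]]; rewrite mulSn; split; first exact: leq_add.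
move=> le; have <- : k = a by lia.
by congr cons; apply: eq_r; lia.
Qed.

Lemma ptab_min k T : (forall i, all (leq (k + i)%N) (nth [::] T i)) ->
  (sumn (flatten (ptab k (shape T))) <= sumn (flatten T))%N /\
  ((sumn (flatten T) <= sumn (flatten (ptab k (shape T))))%N -> T = ptab k (shape T)).
Proof.
elim: T k => [|r T IH] k rT //=.
have [|leT eqT] := IH k.+1; first by move=> i; rewrite addSnnS; apply: (rT i.+1).
have [|ler eqr] := @leq_sumn_nseq k r; first by have := rT 0%N; rewrite addn0.
rewrite !sumn_cat sumn_nseq mulnC; split; first exact: leq_add.
by move=> le; congr (_ :: _); [apply: eqr|apply: eqT]; lia.
Qed.

Lemma ssyt_row_ge la T : sorted geq la -> is_ssyt la T -> forall i, all (leq i) (nth [::] T i).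
Proof.
move=> sla [sh _ colT] i; move: sla colT; rewrite -sh => sla colT; apply/(all_nthP 0%N) => j.
elim: i => // i IH; rewrite -nth_shape => ji.
have ji' := leq_trans ji (leq_nthS i sla); rewrite nth_shape in ji'.
by apply: leq_ltn_trans (IH ji') _; apply: colT.
Qed.

(** The statistic usually written n(la), the sum of [i] times the part of index [i]. It orders the
    partitions for the triangularity below, in place of dominance. *)
Definition nweight la : nat := sumn (flatten (ptab 0 la)).

Lemma size_le_sumn (la : seq nat) : 0%N \notin la -> (size la <= sumn la)%N.
Proof.
elim: la => //= a la IH; rewrite inE negb_or => /andP[a0 /IH]; lia.
Qed.

Lemma head_le_sumn (la : seq nat) : (head 0%N la <= sumn la)%N.
Proof. by case: la => //= a la; apply: leq_addr. Qed.

Lemma all_ptab k N mu : (k + size mu <= N)%N -> all (fun x => x < N)%N (flatten (ptab k mu)).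
Proof.
elim: mu k => //= a mu IH k kN; rewrite all_cat IH ?andbT //; last by lia.
by apply/allP => x /nseqP[-> _]; lia.
Qed.

(** Both bounds are [d], since a partition of [d] has at most [d] columns and its tableau [ptab 0]
    uses entries below [d]. *)
Definition parts (d : nat) : seq (seq nat) :=
  [seq la <- undup [seq shape (tab E) | E <- chains d d] | sumn la == d].

Lemma partsP d la : la \in parts d <-> is_part la /\ sumn la = d.
Proof.
rewrite mem_filter mem_undup; split=> [/andP[/eqP sla /mapP[E /chainsP[_ cE] E']]|[pla sla]].
  by split => //; rewrite E'; apply: part_tab.
rewrite sla eqxx /=.
have : ptab 0 la \in map (@tab d) (chains d d).
  apply/mem_tabs; rewrite shape_ptab; split => //; first exact: ssyt_ptab.
    by rewrite -sla head_le_sumn.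
  by apply: all_ptab; rewrite -sla size_le_sumn //; case: pla.
by move=> /mapP[E EN tE]; rewrite -(shape_ptab 0 la) tE; apply: map_f EN.
Qed.

Lemma parts_uniq d : uniq (parts d).
Proof. by rewrite filter_uniq // undup_uniq. Qed.

Section SchurBasis.
Variable R : comNzRingType.
Implicit Types (F G : fps R) (c : seq nat -> R) (m : monom).

Lemma schur_neq0 la m : schur la m != 0 :> R ->
  exists2 T, is_ssyt la T & m = seq_mset (flatten T).
Proof.
move=> nz; apply: contrapT => no; case/eqP: nz; rewrite /schur /fsum.
apply: fsbig1 => T sT; rewrite /mono; case: (eqVneq m) => // mT.
by case: no; exists T.
Qed.

Lemma schur_degree la m : schur la m != 0 :> R -> sumn la = size m.
Proof.
move=> /schur_neq0[T [<- _ _] ->].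
by rewrite size_seq_mset size_flatten.
Qed.

Lemma sumn_xpart la (T : seq (seq nat)) : xpart la = seq_mset (flatten T) ->
  sumn (flatten T) = nweight la.
Proof. by move=> /eq_seq_msetP; rewrite perm_sym => /perm_sumn. Qed.

(** Triangularity of the Kostka numbers: a tableau of shape [la] and weight [mu] has entry sum
    [nweight mu], and the least entry sum for its shape is [nweight la], attained by [ptab]
    alone. *)
Lemma schur_xpart_le la mu : is_part la -> is_part mu -> schur la (xpart mu) != 0 :> R ->
  (nweight la <= nweight mu)%N /\ ((nweight mu <= nweight la)%N -> la = mu).
Proof.
move=> pla pmu /schur_neq0[T sT muT]; have Tw := sumn_xpart muT.
have [sh _ _] := sT; have := ssyt_row_ge (proj1 pla) sT => /(@ptab_min 0).
rewrite sh Tw; move=> [le eq]; split=> // /eq Tla.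
apply: part_nth_inj => // i.
by have := congr1 (fun A : monom => A i) muT; rewrite !mset_seqE Tla !count_ptab /= subn0.
Qed.

Lemma schur_xpart_id mu : is_part mu -> schur mu (xpart mu) = 1 :> R.
Proof.
move=> pmu; rewrite /schur /fsum (@fsum_seq _ _ _ [:: ptab 0 mu]) //.
- by rewrite big_seq1 /mono eqxx.
- by move=> T; rewrite inE => /eqP ->; apply: ssyt_ptab.
move=> T sT; rewrite /mono; case: (eqVneq (xpart mu)) => [muT _|_]; last by rewrite eqxx.
have := ssyt_row_ge (proj1 pmu) sT => /(@ptab_min 0) [_].
by have [-> _ _] := sT; rewrite (sumn_xpart muT) => -> //; rewrite inE.
Qed.

Definition schur_ser c : fps R :=
  fsum [set la | is_part la] (fun la m => c la * schur la m).

Lemma schur_serE c m : schur_ser c m = \sum_(la <- parts (size m)) c la * schur la m.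
Proof.
rewrite /schur_ser /fsum (@fsum_seq _ _ _ (parts (size m))) //; first exact: parts_uniq.
  by move=> la /partsP[].
move=> la pla nz; apply/partsP; split=> //; apply: schur_degree.
by apply: contraNneq nz => ->; rewrite mulr0.
Qed.

Lemma size_xpart mu : size (xpart mu) = sumn mu.
Proof. by rewrite size_seq_mset size_flatten shape_ptab. Qed.

Lemma schur_ser_xpart c mu : is_part mu -> schur_ser c (xpart mu) =
  c mu + \sum_(la <- parts (sumn mu) | (nweight la < nweight mu)%N) c la * schur la (xpart mu).
Proof.
move=> pmu; rewrite schur_serE size_xpart (bigD1_seq mu) ?parts_uniq //=; last by apply/partsP.
rewrite schur_xpart_id // mulr1; congr (_ + _).
rewrite [LHS]big_mkcond [RHS]big_mkcond; apply: eq_big_seq => la /partsP[pla _].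
have [K0|nz] := eqVneq (schur la (xpart mu) : R) 0; first by rewrite K0 mulr0 !if_same.
have [le eq] := schur_xpart_le pla pmu nz.
have [->|ne] := eqVneq la mu; first by rewrite ltnn.
rewrite ltn_neqAle le andbT; case: eqP => // E.
by rewrite eq ?E ?eqxx in ne.
Qed.

Lemma schur_ser_inj d c c' :
  (forall m, size m = d -> schur_ser c m = schur_ser c' m) ->
  forall la, is_part la -> sumn la = d -> c la = c' la.
Proof.
move=> cc la; have [n] := ubnP (nweight la); elim: n la => // n IH la lan pla sla.
have := cc (xpart la); rewrite size_xpart => /(_ sla); rewrite !schur_ser_xpart // sla.
set S := \sum_(_ <- _ | _) _; rewrite (_ : S = \sum_(mu <- parts d | (nweight mu < nweight la)%N)
  c' mu * schur mu (xpart la)); first by move/addIr.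
rewrite /S [LHS]big_mkcond [RHS]big_mkcond; apply: eq_big_seq => mu /partsP[pmu smu].
by case: ifP => // muw; rewrite IH // (leq_trans muw).
Qed.

(** Forward substitution in the unitriangular system, one value of [nweight] per step; later steps
    keep the earlier values. *)
Fixpoint schur_solve F (n : nat) : seq nat -> R :=
  if n is n'.+1 then
    let c := schur_solve F n' in
    fun mu => if nweight mu == n' then F (xpart mu) -
      \sum_(la <- parts (sumn mu) | (nweight la < n')%N) c la * schur la (xpart mu)
    else c mu
  else fun _ => 0.

Lemma schur_solve_stable F n mu : (nweight mu < n)%N ->
  schur_solve F n mu = schur_solve F (nweight mu).+1 mu.
Proof.
elim: n => // n IH; rewrite ltnS leq_eqVlt => /orP[/eqP ->|mun] //.
by rewrite [LHS]/= (ltn_eqF mun) IH.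
Qed.

(** Symmetry is read off the determinant in the symmetric [elem], without an involution on
    tableaux. *)
Lemma sym_schur la : is_part la -> sym_series (schur la : fps R).
Proof.
by move=> pla; rewrite (schur_JT R pla (leqnn _)); apply: sym_det => i j; rewrite mxE; apply: sym_elem.
Qed.

Lemma sym_schur_ser c : sym_series (schur_ser c).
Proof.
apply/sym_seriesE => s bs m; rewrite !schur_serE size_seq_mset size_map.
apply: eq_big_seq => la /partsP[pla _]; congr (_ * _).
by have /sym_seriesE -> := sym_schur pla.
Qed.

Lemma schur_ser_ex F : sym_series F -> exists c, F = schur_ser c.
Proof.
move=> sF; exists (fun mu => schur_solve F (nweight mu).+1 mu).
apply: sym_xpart => // [|mu pmu]; first exact: sym_schur_ser.
rewrite schur_ser_xpart // [schur_solve _ _ mu]/= eqxx -[LHS](subrK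
  (\sum_(la <- parts (sumn mu) | (nweight la < nweight mu)%N)
     schur_solve F (nweight mu) la * schur la (xpart mu))); congr (_ + _).
by apply: eq_bigr => la law; rewrite schur_solve_stable.
Qed.

Lemma schur_coefP F : sym_series F -> F = schur_ser (schur_coef F).
Proof.
move=> /schur_ser_ex ex; rewrite /schur_coef.
exact: (xgetPex (fun=> 0) (P := [set c | F = schur_ser c]) ex).
Qed.

Lemma schur_coef_ser c la : is_part la -> schur_coef (schur_ser c) la = c la.
Proof.
move=> pla; apply: (@schur_ser_inj (sumn la)) => // m _.
by rewrite -schur_coefP //; apply: sym_schur_ser.
Qed.

End SchurBasis.

(** * Pieri rules *)

Section Determinants.
Variable R : comNzRingType.

Lemma cofactor_eq n (A B : 'M[R]_n) i j :
  (forall x y, x != i -> y != j -> A x y = B x y) -> cofactor A i j = cofactor B i j.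
Proof.
move=> AB; rewrite /cofactor; congr (_ * \det _); apply/matrixP => x y; rewrite !mxE.
by apply: AB; rewrite eq_sym neq_lift.
Qed.

(* Both sides are [\tr (\adj A *m B)]. *)
Lemma sum_det_replace n (A B : 'M[R]_n) :
  \sum_i \det (\matrix_(x, y) (if x == i then B x y else A x y)) =
  \sum_j \det (\matrix_(x, y) (if y == j then B x y else A x y)).
Proof.
transitivity (\sum_i \sum_j B i j * cofactor A i j).
  apply: eq_bigr => i _; rewrite (expand_det_row _ i); apply: eq_bigr => j _.
  rewrite !mxE eqxx; congr (_ * _); apply: cofactor_eq => x y xi _.
  by rewrite mxE (negbTE xi).
rewrite exchange_big /=; apply: eq_bigr => j _; rewrite (expand_det_col _ j).
apply: eq_bigr => i _; rewrite !mxE eqxx; congr (_ * _); apply: cofactor_eq => x y _ yj.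
by rewrite mxE (negbTE yj).
Qed.

Lemma det_col_eq0 n (A : 'M[R]_n) i j : i != j -> (forall x, A x i = A x j) -> \det A = 0.
Proof.
by move=> ij Aij; rewrite -det_tr; apply: (determinant_alternate ij) => x; rewrite !mxE.
Qed.

End Determinants.

Section Pieri.
Variable R : comNzRingType.
Implicit Types (F G : fps R) (m : monom).

Lemma psum1E : psum1 = elem R 1.
Proof.
apply/funext => m; rewrite elemE /psum1 /fsum.
have mono1 i : (mono R [:: i] m != 0) -> m = seq_mset [:: i].
  by rewrite /mono; case: (eqVneq m) => [->//|_]; rewrite eqxx.
have [/eqP[sm]|sm] := boolP (Posz (size m) == 1); last first.
  rewrite andbF; apply: fsbig1 => i _; apply/eqP; apply: contraNT sm => /mono1 ->.
  by rewrite size_seq_mset.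
rewrite andbT; case E: (enum_mset m) sm => [|a []] // _.
have mE : m = seq_mset [:: a] by rewrite -E seq_mset_id.
rewrite (@fsum_seq _ _ _ [:: a]) ?big_seq1 //; first by rewrite /mono mE eqxx.
move=> i _ /mono1; rewrite mE => /eq_seq_msetP /perm_mem /(_ i).
by rewrite !inE eqxx => ->.
Qed.

Definition delta k (j : 'I_k) : 'I_k -> int := fun i => (i == j)%:Z.

(** A new variable lowers by one the indices of a subset of the rows, with one power of the variable
    per row; the linear coefficient comes from the singletons. *)
Lemma pskew_JT k (h : 'I_k -> int) :
  pskew (JT R h) = \sum_j JT R (fun i => h i - delta j i).
Proof.
pose G (e : {set 'I_k}) := JT R (fun i => h i - (i \in e)%:Z).
have step P v : ~~ P v -> res (addv P v) (JT R h) =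
    \sum_(e : {set 'I_k}) mono R [:: v] ^+ #|e| * res P (G e).
  move=> nPv; rewrite JT_Alt /Alt rmorph_sum.
  under eq_bigr do rewrite rmorphM rmorph_sign /= (@eprod_stepper _ _ _ P v) // mulr_sumr.
  rewrite exchange_big /=; apply: eq_bigr => e _.
  rewrite /G JT_Alt /Alt rmorph_sum mulr_sumr; apply: eq_bigr => s _.
  rewrite rmorphM rmorph_sign /= mulrCA; congr (_ * (_ * res P _)).
  apply: eq_bigr => i _; congr (elem R _); rewrite /bump_on /=.
  by ring.
rewrite (_ : \sum_j _ = \sum_(e : {set 'I_k} | #|e| == 1%N) G e).
  apply: (@pskew_rec _ _ (G finset.set0) _ (fun P v =>
     \sum_(e : {set 'I_k} | (1 < #|e|)%N) mono R [:: v] ^+ (#|e| - 2) * res P (G e))) => P v nPv.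
  rewrite step // (bigID (fun e : {set 'I_k} => 1 < #|e|)%N) /= addrC; congr (_ + _).
    rewrite (bigID (fun e : {set 'I_k} => #|e| == 0)%N) /=; congr (_ + _).
      rewrite (big_pred1 finset.set0) ?cards0 ?expr0 ?mul1r // => e.
      by rewrite /= cards_eq0; case: eqP => [->|_]; rewrite ?cards0 ?andbF.
    rewrite rmorph_sum mulr_sumr; apply: eq_big => e; first by case: #|e| => [|[]].
    move=> /= /andP[e2 e0]; have -> : #|e| = 1%N by case: #|e| e2 e0 => [|[]].
    by rewrite expr1.
  rewrite mulr_sumr; apply: eq_bigr => e e2.
  by rewrite mulrA -exprD subnKC.
rewrite (eq_bigl (fun e : {set 'I_k} => e \in [set [set j]%SET | j in 'I_k]%SET)); last first.
  move=> e; apply/cards1P/imsetP => [[j ->]|[j _ ->]]; last by exists j.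
  by exists j.
rewrite big_imset /=; last by move=> i j _ _ /set1_inj.
apply: eq_big => // j _; rewrite /G; congr (JT R _); apply/funext => i.
by rewrite /delta finset.inE.
Qed.

(** An empty column is appended to leave room for a box in a new column. *)
Definition extend0 k (h : 'I_k -> int) : 'I_k.+1 -> int :=
  fun i => if unlift ord_max i is Some j then h j else 0.

(** Raising the index of one row replaces its entries by those one column further right. After
    [sum_det_replace] trades rows for columns, every replaced column but the last duplicates its
    neighbour, and the last row of the surviving matrix is zero except for [elem 1]. *)
Lemma psum1_JT k (h : 'I_k -> int) :
  psum1 * JT R h = \sum_j JT R (fun i => extend0 h i + delta j i).
Proof.
pose A := \matrix_(i < k.+1, j < k.+1) elem R (extend0 h i - i%:Z + j%:Z).
pose B := \matrix_(i < k.+1, j < k.+1) elem R (extend0 h i - i%:Z + (j.+1)%:Z).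
transitivity (\sum_i \det (\matrix_(x, y) (if x == i then B x y else A x y))); last first.
  apply: eq_bigr => i _; congr (\det _); apply/matrixP => x y; rewrite !mxE /delta.
  by case: eqP => _; congr (elem R _); lia.
rewrite sum_det_replace big_ord_recr /= big1 ?add0r => [|j _]; last first.
  have jk : (j.+1 < k.+1)%N by rewrite ltnS ltn_ord.
  have ne : widen_ord (leqnSn k) j != Ordinal jk by rewrite -val_eqE /= ltn_eqF.
  apply: (det_col_eq0 ne) => x; rewrite !mxE eqxx (eq_sym (Ordinal jk)) (negbTE ne).
  by [].
rewrite (expand_det_row _ ord_max) big_ord_recr /= big1 ?add0r => [|j _]; last first.
  rewrite !mxE -val_eqE /= (ltn_eqF (ltn_ord j)) ?mxE /extend0 unlift_none /=.
  by rewrite elem_neg ?mul0r //; have := ltn_ord j; lia.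
rewrite !mxE eqxx ?mxE {1}/extend0 unlift_none psum1E; congr (elem R _ * _); first by rewrite /=; lia.
rewrite /cofactor -signr_odd /= addnn odd_double expr0 mul1r; congr (\det _).
apply/matrixP => i j; rewrite !mxE (eq_sym _ ord_max) (negbTE (neq_lift _ _)) ?mxE /extend0 liftK.
by rewrite !lift_max.
Qed.

End Pieri.

Definition part_of (k : nat) (h : nat -> nat) : seq nat := mkseq (conj (mkseq h k)) (h 0%N).

Lemma part_ofP k (h : nat -> nat) : (forall i j, (i <= j)%N -> (h j <= h i)%N) ->
  (forall j, (k <= j)%N -> h j = 0%N) -> is_part (part_of k h) /\ conj (part_of k h) =1 h.
Proof.
move=> hd h0; have ss : sorted geq (mkseq h k).
  apply/(sortedP 0%N) => i; rewrite size_mkseq => ik.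
  by rewrite !nth_mkseq ?(ltnW ik) //=; apply: hd.
have nthh j : nth 0%N (mkseq h k) j = h j.
  have [jk|kj] := ltnP j k; first by rewrite nth_mkseq.
  by rewrite nth_default ?size_mkseq // h0.
have sp : sorted geq (part_of k h).
  apply/(sortedP 0%N) => i; rewrite size_mkseq => ih.
  by rewrite !nth_mkseq ?(ltnW ih) //=; apply: conj_dec.
split.
  split => //; apply/negP => /mapP[i]; rewrite mem_iota add0n => /= ih.
  by apply/eqP; rewrite eq_sym -lt0n count_geq // nthh.
move=> j; have H i : (i < conj (part_of k h) j)%N = (i < h j)%N.
  rewrite count_geq //; have [ih|hi] := ltnP i (h 0%N); first by rewrite nth_mkseq // count_geq ?nthh.
  rewrite nth_default ?size_mkseq //; apply/esym/negbTE; rewrite -leqNgt.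
  by apply: leq_trans hi; apply: hd.
by apply/eqP; rewrite eqn_leq leqNgt H ltnn /= leqNgt -H ltnn.
Qed.

Lemma sumn_conj k la : all (fun p => p <= k)%N la -> sumn la = (\sum_(j < k) conj la j)%N.
Proof.
elim: la => [|a la IH] /=; first by rewrite big1.
move=> /andP[ak /IH ->]; rewrite big_split /=; congr (_ + _)%N.
rewrite -(big_mkord xpredT (fun j => (j < a) : nat)) /= /index_iota subn0.
rewrite -(subnKC ak) iotaD big_cat /= [X in (_ + X)%N]big1_seq => [|j]; last first.
  by rewrite /= mem_iota add0n => /andP[aj _]; rewrite ltnNge aj.
rewrite addn0 (eq_big_seq (fun=> 1%N)); first by rewrite big_const_seq count_predT size_iota iter_addn_0 mul1n.
by move=> j; rewrite mem_iota => /= ->.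
Qed.

Lemma conj_oob la k j : is_part la -> (head 0%N la <= k)%N -> (k <= j)%N -> conj la j = 0%N.
Proof.
move=> [sla _] lak kj; apply/eqP; rewrite -leqn0 leqNgt count_geq // nth0 -leqNgt.
exact: leq_trans lak kj.
Qed.

Lemma all_head la : is_part la -> all (fun p => p <= head 0%N la)%N la.
Proof. by move=> [sla _]; apply/(all_nthP 0%N) => i _; apply: leq_head. Qed.

Lemma sumn_conj_head k la : is_part la -> (head 0%N la <= k)%N ->
  sumn la = (\sum_(j < k) conj la j)%N.
Proof.
move=> pla lak; apply: sumn_conj; apply: sub_all (all_head pla) => p pl.
exact: leq_trans lak.
Qed.

Definition cov (mu la : seq nat) (j : nat) : bool :=
  `[< forall i, conj la i = (conj mu i + (i == j))%N >].

(** For partitions it is 1 when [la] covers [mu] in Young's lattice and 0 otherwise. The range is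
    large enough: the column of the added box is below the first part, hence below the size of
    [la]. *)
Definition Nbox (mu la : seq nat) : nat := (\sum_(j < sumn la) cov mu la j)%N.

Section PieriSchur.
Variable R : comNzRingType.
Implicit Types (F G : fps R) (m : monom).

(** Written as a sum with a single term, so that an empty sum can stand for the vanishing
    determinants in [JT_up] and [JT_down]. *)
Lemma JT_dec k (h : nat -> nat) d : (forall i j, (i <= j)%N -> (h j <= h i)%N) ->
  (forall j, (k <= j)%N -> h j = 0%N) -> d = (\sum_(j < k) h j)%N ->
  JT R (fun i : 'I_k => (h i)%:Z) = \sum_(la <- parts d | `[< conj la =1 h >]) schur la.
Proof.
move=> hd h0 ->; have [pp cp] := part_ofP hd h0.
have hk : (head 0%N (part_of k h) <= k)%N.
  rewrite -nth0 leqNgt -count_geq ?(proj1 pp) // -/(conj _ _) cp h0 //.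
rewrite -big_filter (_ : filter _ _ = [:: part_of k h]).
  rewrite big_seq1 (schur_JT R pp hk); congr (JT R _); apply/funext => i.
  by rewrite cp.
apply: perm_small_eq => //; apply: uniq_perm => //; first exact: filter_uniq (parts_uniq _).
move=> la; rewrite mem_filter inE; apply/andP/eqP => [[/asboolP ch /partsP[pla _]]|->].
  by apply: conj_inj => // i; rewrite ch cp.
split; first exact/asboolP.
apply/partsP; split=> //; rewrite (sumn_conj_head pp hk).
by apply: eq_bigr => j _; rewrite cp.
Qed.

(** If column [j] cannot take a box it is as high as column [j - 1], and then rows [j - 1] and [j]
    of the determinant coincide. *)
Lemma JT_up k mu (j : 'I_k) : is_part mu -> (head 0%N mu <= k)%N ->
  JT R (fun i : 'I_k => (conj mu i)%:Z + delta j i) =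
  \sum_(la <- parts (sumn mu).+1 | cov mu la j) schur la.
Proof.
move=> pmu muk; pose h i := (conj mu i + (i == j))%N.
have [dj|] := boolP ((j == 0 :> nat) || (conj mu j < conj mu j.-1)%N).
  have -> : (fun i : 'I_k => (conj mu i)%:Z + delta j i) = (fun i : 'I_k => (h i)%:Z).
    by apply/funext => i; rewrite /h PoszD /delta val_eqE.
  apply: JT_dec.
  - move=> x y xy; rewrite /h; have := conj_dec mu xy.
    case: (eqVneq y j) => [yj|_]; last by lia.
    case: (eqVneq x j) => [xj|xj]; first by lia.
    move: dj; case: (nat_of_ord j) yj xj => [|j'] /= yj xj; first by lia.
    have : (conj mu j' <= conj mu x)%N by apply: conj_dec; lia.
    by rewrite yj; lia.
  - move=> i ki; rewrite /h (conj_oob pmu muk ki) (_ : (i == j) = false) //.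
    by apply/eqP => E; rewrite E leqNgt ltn_ord in ki.
  - rewrite big_split /= -(sumn_conj_head pmu muk) (bigD1 j) //= eqxx big1 ?addn1 //.
    by move=> i ij; rewrite val_eqE (negbTE ij).
rewrite negb_or -leqNgt => /andP[j0 cj]; have j1k : (j.-1 < k)%N by have := ltn_ord j; lia.
rewrite big1 => [|la /asboolP cl]; last first.
  have := conj_dec la (leq_pred j); rewrite !cl eqxx (_ : (j.-1 == j) = false); lia.
have ne : j != Ordinal j1k by rewrite -val_eqE /=; lia.
apply: (determinant_alternate ne) => x; rewrite !mxE /delta eqxx (eq_sym _ j) (negbTE ne) /=.
have cd := conj_dec mu (leq_pred j); congr (elem R _); lia.
Qed.

(** If column [j] has no removable box, rows [j] and [j + 1] coincide; when [j] is the last index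
    the column is empty and row [j] has only negative indices. *)
Lemma JT_down k la (j : 'I_k) : is_part la -> (head 0%N la <= k)%N ->
  JT R (fun i : 'I_k => (conj la i)%:Z - delta j i) =
  \sum_(mu <- parts (sumn la).-1 | cov mu la j) schur mu.
Proof.
move=> pla lak; pose h i := (conj la i - (i == j))%N.
have sl := sumn_conj_head pla lak.
have [dj|dj] := boolP (conj la j.+1 < conj la j)%N.
  have -> : (fun i : 'I_k => (conj la i)%:Z - delta j i) = (fun i : 'I_k => (h i)%:Z).
    apply/funext => i; rewrite /h /delta val_eqE; case: eqP => [->|_]; lia.
  rewrite (@JT_dec _ h (sumn la).-1); last first.
  - rewrite sl (bigD1 j) //= [X in _ = X](bigD1 j) //= /h eqxx.
    rewrite [X in _ = (_ + X)%N](eq_bigr (fun i : 'I_k => conj la i)); first by lia.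
    by move=> i ij; rewrite val_eqE (negbTE ij) subn0.
  - by move=> i ki; rewrite /h (conj_oob pla lak ki).
  - move=> x y xy; rewrite /h; have := conj_dec la xy.
    case: (eqVneq x j) => [xj|_]; last by lia.
    case: (eqVneq y j) => [yj|yj]; first by lia.
    have : (conj la y <= conj la j.+1)%N by apply: conj_dec; lia.
    by rewrite xj; lia.
  apply: eq_bigl => mu; apply: asbool_equiv_eq; split=> cm i; first rewrite cm /h.
    by case: (eqVneq i j) => [->|_]; lia.
  by rewrite /h cm; lia.
rewrite big1 => [|mu /asboolP cl]; last first.
  have cd := conj_dec mu (leqnSn j); case/negP: dj; rewrite !cl eqxx (_ : (j.+1 == j) = false); lia.
have cj : conj la j.+1 = conj la j.
  by apply/eqP; rewrite eqn_leq conj_dec //= leqNgt.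
have [j1k|kj] := ltnP j.+1 k.
  have ne : j != Ordinal j1k by rewrite -val_eqE /=; lia.
  apply: (determinant_alternate ne) => x; rewrite !mxE /delta eqxx (eq_sym _ j) (negbTE ne) /=.
  by congr (elem R _); lia.
rewrite /JT (expand_det_row _ j) big1 // => x _; rewrite !mxE /delta eqxx elem_neg ?mul0r //.
rewrite -cj (conj_oob pla lak kj); have := ltn_ord x; lia.
Qed.

Lemma sum_cov (I : Type) (r : seq I) d (c : I -> nat -> bool) (F : I -> fps R) :
  \sum_(j < d) \sum_(x <- r | c x j) F x = \sum_(x <- r) F x *+ (\sum_(j < d) c x j)%N.
Proof.
transitivity (\sum_(j < d) \sum_(x <- r) F x *+ c x j).
  by apply: eq_bigr => j _; rewrite [LHS]big_mkcond; apply: eq_bigr => x _; case: (c x j).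
by rewrite exchange_big; apply: eq_bigr => x _; rewrite /= sumrMnr.
Qed.

(** Together with [psum1_schur]: [pskew] and multiplication by [psum1] have transposed matrices in
    the Schur basis, which is adjointness. *)
Lemma pskew_schur la : is_part la ->
  pskew (schur la) = \sum_(mu <- parts (sumn la).-1) schur mu *+ Nbox mu la :> fps R.
Proof.
move=> pla; rewrite (schur_JT R pla (head_le_sumn la)) pskew_JT.
rewrite -[RHS](sum_cov _ _ (fun mu j => cov mu la j)).
by apply: eq_bigr => j _; rewrite (JT_down j pla (head_le_sumn la)).
Qed.

Lemma psum1_schur mu : is_part mu ->
  psum1 * schur mu = \sum_(la <- parts (sumn mu).+1) schur la *+ Nbox mu la :> fps R.
Proof.
move=> pmu; rewrite (schur_JT R pmu (head_le_sumn mu)) psum1_JT.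
rewrite [RHS](eq_big_seq (fun la => schur la *+ (\sum_(j < (sumn mu).+1) cov mu la j)%N)); last first.
  by move=> la /partsP[_ sla]; rewrite /Nbox sla.
rewrite -[RHS](sum_cov _ _ (cov mu)); apply: eq_bigr => j _; rewrite -JT_up //; last exact: leqW (head_le_sumn mu).
congr (JT R _); apply/funext => i; congr (_ + _); rewrite /extend0.
case: unliftP => [i' ->|->]; first by rewrite lift_max.
by rewrite (conj_oob pmu (head_le_sumn mu)).
Qed.

End PieriSchur.

(** * Skewing by the first power sum *)

Section Skewing.
Variable R : comNzRingType.
Implicit Types (F G f g h : fps R) (c : seq nat -> R) (m : monom).

Lemma fps_mulrnE F n m : (F *+ n) m = F m *+ n.
Proof. by elim: n => // n IH; rewrite !mulrS fps_addE IH. Qed.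

Lemma pskew_schur_ser c : pskew (schur_ser c) =
  schur_ser (fun mu => \sum_(la <- parts (sumn mu).+1) c la *+ Nbox mu la).
Proof.
apply/funext => m; rewrite [LHS]/pskew !schur_serE -mset1_seq size_msetD size_seq_mset /=.
transitivity (\sum_(la <- parts (size m).+1) \sum_(mu <- parts (size m))
   (c la *+ Nbox mu la) * schur mu m).
  apply: eq_big_seq => la /partsP[pla sla]; rewrite mset1_seq -[schur la _]/(pskew (schur la) m).
  rewrite (pskew_schur R pla) sla fps_sumE mulr_sumr; apply: eq_bigr => mu _.
  by rewrite fps_mulrnE mulrnAr mulrnAl.
rewrite exchange_big /=; apply: eq_big_seq => mu /partsP[_ smu].
by rewrite -mulr_suml smu.
Qed.

Lemma psum1_schur_ser c : psum1 * schur_ser c =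
  schur_ser (fun la => \sum_(mu <- parts (sumn la).-1) c mu *+ Nbox mu la).
Proof.
apply/funext => m; rewrite schur_serE.
transitivity (\sum_(mu <- parts (size m).-1) c mu * (psum1 * schur mu) m).
  rewrite fps_mulrE; under [RHS]eq_bigr do rewrite fps_mulrE mulr_sumr.
  rewrite [RHS]exchange_big /=; apply: eq_big_seq => -[p q]; rewrite mem_splitting /= => /eqP pq.
  (* Only splittings with a first factor of degree 1 matter, so [schur_ser c] is needed in degree
     [size m - 1] alone. *)
  have [sp|sp] := eqVneq (size (enum_mset p)) 1%N; last first.
    rewrite psum1E elemE eqz_nat (negbTE sp) andbF mul0r big1 // => mu _.
    by rewrite mul0r mulr0.
  rewrite schur_serE -pq size_msetD sp mulr_sumr; apply: eq_bigr => mu _.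
  by rewrite mulrCA.
(* In degree 0 the predecessor is again 0; both sides vanish, by the missing constant term of
   [psum1] and by the empty sum in [Nbox]. *)
have [m0|m0] := posnP (size m).
  rewrite m0 (mset_size0 m0) [LHS]big1_seq; last first.
    move=> mu /andP[_ /partsP[pmu smu]]; rewrite -[X in _ * X]/(coef0 _) rmorphM psum1E /=.
    by rewrite coef0_elem mul0r mulr0.
  rewrite big1_seq // => la /andP[_ /partsP[_ sla]]; rewrite sla big1 ?mul0r // => mu _.
  by rewrite /Nbox sla big_ord0.
transitivity (\sum_(mu <- parts (size m).-1) \sum_(la <- parts (size m))
   (c mu *+ Nbox mu la) * schur la m).
  apply: eq_big_seq => mu /partsP[pmu smu].
  rewrite (psum1_schur R pmu) smu prednK // fps_sumE mulr_sumr; apply: eq_bigr => la _.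
  by rewrite fps_mulrnE mulrnAr mulrnAl.
rewrite exchange_big /=; apply: eq_big_seq => la /partsP[_ sla].
by rewrite -mulr_suml sla.
Qed.

Definition parts_below (D : nat) : seq (seq nat) := undup (flatten [seq parts d | d <- iota 0 D]).

Lemma parts_belowP D la : la \in parts_below D <-> is_part la /\ (sumn la < D)%N.
Proof.
rewrite mem_undup; split=> [/flattenP[p /mapP[d]]|[pla sla]].
  by rewrite mem_iota add0n => /= dD -> /partsP[pla ->].
by apply/flattenP; exists (parts (sumn la)); [apply: map_f; rewrite mem_iota|apply/partsP].
Qed.

Lemma big_parts_below D d (F : seq nat -> R) : (d < D)%N ->
  \sum_(la <- parts d) F la = \sum_(la <- parts_below D | sumn la == d) F la.
Proof.
move=> dD; rewrite -[RHS]big_filter; apply: perm_big; apply: uniq_perm.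
- exact: parts_uniq.
- by apply: filter_uniq; apply: undup_uniq.
move=> la; rewrite [in RHS]mem_filter; apply/idP/andP => [/partsP[pla sla]|[/eqP sla /parts_belowP[pla _]]].
  by split; [apply/eqP|apply/parts_belowP; rewrite sla].
exact/partsP.
Qed.

Lemma hall_below D F G : (forall la, is_part la -> (D <= sumn la)%N -> schur_coef G la = 0) ->
  hall F G = \sum_(la <- parts_below D) schur_coef F la * schur_coef G la.
Proof.
move=> G0; rewrite /hall (@fsum_seq _ _ _ (parts_below D)) //; first exact: undup_uniq.
  by move=> la /parts_belowP[].
move=> la pla nz; apply/parts_belowP; split=> //; rewrite ltnNge.
by apply: contraNN nz => Dla; rewrite G0 // mulr0.
Qed.

Lemma schur_coef_bound G D : sym_series G ->
  (forall s : seq nat, (D < size s)%N -> G (seq_mset s) = 0) ->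
  forall la, is_part la -> (D < sumn la)%N -> schur_coef G la = 0.
Proof.
move=> sG G0 la pla Dla; apply: (@schur_ser_inj _ (sumn la) _ (fun=> 0)) => // m sm.
rewrite -schur_coefP // -[m]seq_mset_id G0 ?sm // schur_serE big1 // => mu _.
by rewrite mul0r.
Qed.

Lemma hall_pskew g f : sym_series g -> sym_fun f -> hall (pskew g) f = hall g (psum1 * f).
Proof.
move=> sg [sf [D fD]]; set cg := schur_coef g; set cf := schur_coef f.
have f0 la : is_part la -> (D.+1 <= sumn la)%N -> cf la = 0 by apply: schur_coef_bound.
have pgE : pskew g = schur_ser (fun mu => \sum_(la <- parts (sumn mu).+1) cg la *+ Nbox mu la).
  by rewrite {1}(schur_coefP sg) pskew_schur_ser.
have pfE : psum1 * f = schur_ser (fun la => \sum_(mu <- parts (sumn la).-1) cf mu *+ Nbox mu la).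
  by rewrite {1}(schur_coefP sf) psum1_schur_ser.
(* The degree of [f] is at most [D], hence that of [psum1 * f] at most [D + 1]. *)
rewrite (@hall_below D.+1 _ f) // (@hall_below D.+2 g); last first.
  move=> la pla Dla; rewrite pfE schur_coef_ser // big1_seq // => mu /andP[_ /partsP[pmu smu]].
  by rewrite f0 ?mul0rn // smu; lia.
transitivity (\sum_(mu <- parts_below D.+1) \sum_(la <- parts_below D.+2 | sumn la == (sumn mu).+1)
   cg la * cf mu *+ Nbox mu la).
  apply: eq_big_seq => mu /parts_belowP[pmu smu]; rewrite pgE schur_coef_ser //.
  rewrite (@big_parts_below D.+2) // mulr_suml; apply: eq_bigr => la _.
  by rewrite -/cf mulrnAl.
rewrite (exchange_big_dep xpredT) //=; apply: eq_big_seq => la /parts_belowP[pla sla].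
rewrite pfE schur_coef_ser // (@big_parts_below D.+1); last by lia.
rewrite mulr_sumr [LHS]big_mkcond [RHS]big_mkcond; apply: eq_bigr => mu _.
have [l0|l0] := posnP (sumn la).
  by rewrite l0 /= /Nbox l0 big_ord0 mulr0n mulr0 if_same.
have -> : (sumn la == (sumn mu).+1) = (sumn mu == (sumn la).-1) by lia.
by case: ifP; rewrite // mulrnAr.
Qed.

Lemma sym_fun_schur la : is_part la -> sym_fun (schur la : fps R).
Proof.
move=> pla; split; first exact: sym_schur.
exists (sumn la) => s las; apply/eqP; apply: contraTT las => /schur_degree ->.
by rewrite size_seq_mset ltnn.
Qed.

Lemma schur_serK la : is_part la -> schur la = schur_ser (fun mu => (mu == la)%:R) :> fps R.
Proof.
move=> pla; apply/funext => m; rewrite schur_serE.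
have [sm|sm] := eqVneq (sumn la) (size m).
  rewrite (bigD1_seq la) ?parts_uniq //=; last exact/partsP.
  by rewrite eqxx mul1r big1 ?addr0 // => mu /negbTE ->; rewrite mul0r.
rewrite big1_seq => [|mu /andP[_ /partsP[_ smu]]].
  by apply/eqP; apply: contraNT sm => /schur_degree ->.
by case: eqP => [E|_]; rewrite ?mul0r //; rewrite -smu E eqxx in sm.
Qed.

Lemma hall_schur F la : is_part la -> hall F (schur la) = schur_coef F la.
Proof.
move=> pla; have cE mu : is_part mu -> schur_coef (schur la : fps R) mu = (mu == la)%:R.
  by move=> pmu; rewrite schur_serK // schur_coef_ser.
rewrite (@hall_below (sumn la).+1) => [|mu pmu lamu]; last first.
  by rewrite cE //; case: eqP lamu => // ->; rewrite ltnn.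
rewrite (bigD1_seq la) ?undup_uniq //=; last exact/parts_belowP.
rewrite cE // eqxx mulr1 big_seq_cond big1 ?addr0 // => mu /andP[/parts_belowP[pmu _] ne].
by rewrite cE // (negbTE ne) mulr0.
Qed.

(** [pskew g] shows that a candidate exists; any two candidates pair equally with all Schur
    functions, so they have the same Schur coefficients. *)
Lemma skewing_psum1 g : sym_series g -> skewing psum1 g = pskew g.
Proof.
move=> sg; pose S := [set h | sym_series h /\ forall k, sym_fun k -> hall h k = hall g (psum1 * k)].
have Spg : S (pskew g).
  by split; [exact: sym_pskew|move=> k sk; exact: hall_pskew].
have [sh hE] : S (skewing psum1 g) by apply: xgetPex; exists (pskew g).
have spg := sym_pskew sg.
apply: (sym_xpart sh spg) => mu pmu; rewrite (schur_coefP sh) (schur_coefP spg) !schur_serE.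
apply: eq_big_seq => la /partsP[pla _]; congr (_ * _).
have sla := sym_fun_schur pla.
by rewrite -!hall_schur // hE // hall_pskew.
Qed.

End Skewing.

(** * Bounded sums of Schur functions as alternating sums *)

Section QProduct.
Variables (R : comNzRingType) (w b : nat).

Local Notation k := (w + w + b)%N.
Local Notation "''x_' v" := (mono R [:: v]) (at level 8, v at level 2, format "''x_' v").

(** The index [i] is paired with [w + i]; the last [b] indices are unpaired, and [b] will be the
    parity of the bound on the parts. *)
Definition lix (i : 'I_w) : 'I_k := lshift b (lshift w i).
Definition rix (i : 'I_w) : 'I_k := lshift b (rshift w i).
Definition uix (j : 'I_b) : 'I_k := rshift (w + w) j.

Lemma big_ix (S : Type) (idx : S) (op : Monoid.com_law idx) (F : 'I_k -> S) :
  \big[op/idx]_x F x =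
  op (\big[op/idx]_i op (F (lix i)) (F (rix i))) (\big[op/idx]_j F (uix j)).
Proof. by rewrite big_split_ord /= big_split_ord /= -big_split. Qed.

(** Distributivity: independent choices for each pair and each unpaired index form one function on
    all indices. *)
Lemma prod_sum_ix (S : comPzSemiRingType) (T : finType) (F : 'I_w -> T -> T -> S) (G : 'I_b -> T -> S) :
  (\prod_i \sum_c \sum_d F i c d) * (\prod_j \sum_c G j c) =
  \sum_(f : {ffun 'I_k -> T}) (\prod_i F i (f (lix i)) (f (rix i))) * \prod_j G j (f (uix j)).
Proof.
under eq_bigr do rewrite pair_bigA.
rewrite !bigA_distr_bigA /= big_distrlr /= pair_bigA /=.
pose to_ix (f : {ffun 'I_k -> T}) : {ffun 'I_w -> T * T} * {ffun 'I_b -> T} :=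
  ([ffun i => (f (lix i), f (rix i))], [ffun j => f (uix j)]).
pose of_ix (f : {ffun 'I_w -> T * T} * {ffun 'I_b -> T}) : {ffun 'I_k -> T} :=
  [ffun x : 'I_k => match fintype.split x with
    | inl y => match fintype.split y with inl i => (f.1 i).1 | inr i => (f.1 i).2 end
    | inr j => f.2 j
    end].
have to_ixK : cancel to_ix of_ix.
  move=> f; apply/ffunP => x; rewrite ffunE /to_ix /=.
  case: fintype.splitP => [y|j] xy; last by rewrite ffunE; congr (f _); apply: val_inj.
  by case: fintype.splitP => i yi; rewrite ffunE /=; congr (f _); apply: val_inj; rewrite /= xy yi.
have of_ixK : cancel of_ix to_ix.
  move=> [f f']; rewrite /to_ix; congr pair; apply/ffunP => i; rewrite !ffunE.
    rewrite /lix /rix !(unsplitK (inl _)).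
    by rewrite (unsplitK (inr i)) /=; case: (f i).
  by rewrite /uix (unsplitK (inr i)).
rewrite (reindex to_ix) /=; last by apply: onW_bij; exists of_ix.
by apply: eq_bigr => f _; congr (_ * _); apply: eq_bigr => i _; rewrite ffunE.
Qed.

Definition qprod (a : 'I_k -> int) : fps R :=
  (\prod_(i < w) qser R (a (lix i) - a (rix i))) * esum ^+ b.

(** The terms of [hop] correspond to moving neither, either or both indices of a pair; the factor
    [1 + x_v] of [esum] corresponds to an unpaired index, whose argument does not enter the
    product. *)
Lemma qprod_stepper : stepper qprod.
Proof.
move=> P v a nPv; rewrite /qprod rmorphM rmorph_prod rmorphXn /= esum_rec // exprMn.
pose Q d := res P (qser R d).
pose g i (c d : bool) := 'x_v ^+ (c + d) * Q (a (lix i) - a (rix i) + c%:Z - d%:Z).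
have step i : res (addv P v) (qser R (a (lix i) - a (rix i))) = \sum_c \sum_d g i c d.
  rewrite qser_rec // !big_bool /g.
  set d := a (lix i) - a (rix i); transitivity ('x_v ^+ 2 * Q d + 'x_v ^+ 1 * Q (d + 1) +
    ('x_v ^+ 1 * Q (d - 1) + 'x_v ^+ 0 * Q d)).
    by rewrite /hop rmorphD /= -!/(Q _); move: 'x_v => x; ring.
  by congr (_ * Q _ + _ * Q _ + (_ * Q _ + _ * Q _)); rewrite /=; lia.
have stepu : (1 + 'x_v) ^+ b = \prod_(j < b) \sum_(c : bool) 'x_v ^+ c :> fps R.
  by rewrite prodr_const card_ord big_bool expr1 expr0 addrC.
rewrite (eq_bigr _ (fun i _ => step i)) stepu mulrA prod_sum_ix.
rewrite (reindex (fun e : {set 'I_k} => [ffun x => x \in e])) /=; last first.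
  apply: onW_bij; exists (fun f : {ffun 'I_k -> bool} => [set x | f x]%SET) => f.
    by apply/setP => x; rewrite finset.inE ffunE.
  by apply/ffunP => x; rewrite ffunE finset.inE.
rewrite mulr_suml; apply: eq_bigr => e _.
rewrite rmorphM rmorph_prod rmorphXn /= mulrA; congr (_ * _).
have -> : #|e| = (\sum_(i < w) ((lix i \in e) + (rix i \in e)) + \sum_(j < b) (uix j \in e))%N.
  by rewrite -sum1_card big_mkcond big_ix /=; congr (_ + _)%N; apply: eq_bigr => i _; do !case: ifP.
rewrite exprD !expr_sum mulrAC -big_split /=; congr (_ * _).
  by apply: eq_bigr => i _; rewrite /g !ffunE /bump_on /=; congr (_ * Q _); ring.
by apply: eq_bigr => j _; rewrite ffunE.
Qed.

(** Constant terms of [qser] are signs of differences, and along a decreasing argument these depend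
    only on the order of the indices. *)
Lemma coef0_Alt_qprod (a a' : 'I_k -> int) : decreasing a -> decreasing a' ->
  coef0 (Alt qprod a) = coef0 (Alt qprod a').
Proof.
move=> da da'; rewrite !rmorph_sum; apply: eq_bigr => s _; rewrite !rmorphM !rmorph_prod /=.
congr (_ * (_ * _)); apply: eq_bigr => i _ /=.
case: (ltngtP (s (lix i)) (s (rix i))) => [lt|lt|/val_inj ->]; last by rewrite !subrr.
  by have h := da _ _ lt; have h' := da' _ _ lt; rewrite !coef0_qser_gt0 // subr_gt0.
by have h := da _ _ lt; have h' := da' _ _ lt; rewrite !coef0_qser_lt0 // subr_lt0.
Qed.

Lemma Alt_qprod_bounded (m : monom) :
  Alt qprod (heights (fun _ => 0%N)) m = coef0 (Alt qprod (heights (fun _ => 0%N))) *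
    (fsum [set la | is_part la /\ (head 0 la <= k)%N] schur : fps R) m.
Proof.
rewrite (Alt_coef qprod_stepper (all_fresh m)) (part_tabs_schur k R (all_fresh m)) mulr_sumr.
apply: eq_big_seq => E /chainsP[_ cE]; rewrite mulrC; congr (_ * _).
by apply: coef0_Alt_qprod; apply: heights_decreasing => //; apply: chain_dec.
Qed.

End QProduct.

(** * Evaluation of the Pfaffian *)

Section Pfaffian.
Variables (w b : nat).

Local Notation k := (w + w + b)%N.
Local Notation lix := (@lix w b).
Local Notation rix := (@rix w b).
Local Notation uix := (@uix w b).

(* For [b = 0] and an alternating [A] this is a multiple of the Pfaffian of [A]. *)
Definition AltM (S : comNzRingType) (A : 'M[S]_k) (eps : 'I_k -> S) : S :=
  \sum_(s : 'S_k) (-1) ^+ s * ((\prod_i A (s (lix i)) (s (rix i))) * \prod_j eps (s (uix j))).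

(** The rule Pf(P A P^T) = det(P) Pf(A), by multilinear expansion over all maps of the indices:
    non-injective maps give a determinant with two equal rows, injective ones are permutations and
    contribute their sign. *)
Lemma AltM_congr (S : comNzRingType) (P A : 'M[S]_k) (eps : 'I_k -> S) :
  AltM (P *m A *m P^T) (fun x => \sum_y P x y * eps y) = \det P * AltM A eps.
Proof.
pose t (f : 'I_k -> 'I_k) := (\prod_i A (f (lix i)) (f (rix i))) * \prod_j eps (f (uix j)).
have expand (g : 'I_k -> 'I_k) :
    (\prod_i (P *m A *m P^T) (g (lix i)) (g (rix i))) * \prod_j \sum_y P (g (uix j)) y * eps y =
    \sum_(f : {ffun 'I_k -> 'I_k}) (\prod_x P (g x) (f x)) * t f.
  under eq_bigr => i _.
    rewrite mxE; under eq_bigr => z _ do rewrite !mxE mulr_suml.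
    rewrite exchange_big /=; over.
  rewrite (prod_sum_ix (fun i y z => P (g (lix i)) y * A y z * P (g (rix i)) z)
    (fun j y => P (g (uix j)) y * eps y)).
  apply: eq_bigr => f _; rewrite big_ix /= /t !big_split /=; ring.
transitivity (\sum_(f : {ffun 'I_k -> 'I_k}) \det (\matrix_(x, y) P y (f x)) * t f).
  rewrite /AltM; under eq_bigr do rewrite expand mulr_sumr.
  rewrite exchange_big /=; apply: eq_bigr => f _; rewrite mulr_suml; apply: eq_bigr => s _.
  by rewrite mulrA; congr (_ * _ * _); apply: eq_bigr => x _; rewrite mxE.
rewrite (bigID (fun f : {ffun 'I_k -> 'I_k} => injectiveb f)) /= addrC big1 ?add0r; last first.
  move=> f /injectivePn[x [y xy fxy]].
  by rewrite (determinant_alternate xy) ?mul0r // => z; rewrite !mxE fxy.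
rewrite (reindex (@pval _)) /=; last first.
  pose in_Sk := insubd (perm_one 'I_k).
  by exists in_Sk => /= f Uf; first apply: val_inj; apply: insubdK.
rewrite mulr_sumr; apply: eq_big => /= [s|s _]; first by rewrite (valP s).
rewrite pvalE.
have -> : \matrix_(x, y) P y (s x) = row_perm s P^T by apply/matrixP => x y; rewrite !mxE.
by rewrite row_permE det_mulmx det_perm det_tr -mulrA mulrCA.
Qed.

Definition isU (S : comNzRingType) (x : 'I_k) : S := if fintype.split x is inr _ then 1 else 0.

Lemma isU_l (S : comNzRingType) y : isU S (lshift b y) = 0.
Proof. by rewrite /isU (unsplitK (inl y)). Qed.

Lemma isU_u (S : comNzRingType) j : isU S (uix j) = 1.
Proof. by rewrite /isU (unsplitK (inr j)). Qed.

Hypothesis b1 : (b <= 1)%N.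

(* As there is at most one unpaired index, it is fixed by the permutations which contribute. *)
Lemma prod_isU (S : comNzRingType) (s : 'S_k) :
  (exists2 r : 'I_(w + w) -> 'I_(w + w), forall y, s (lshift b y) = lshift b (r y)
     & forall j, s (uix j) = uix j) \/ \prod_j isU S (s (uix j)) = 0.
Proof.
have uE (j j' : 'I_b) : j = j' by apply: ord_inj; have := ltn_ord j; have := ltn_ord j'; lia.
have [su|/existsNP[j sj]] := pselect (forall j, s (uix j) = uix j); last first.
  right; rewrite (bigD1 j) //= /isU; case: fintype.splitP => [y yE|j' sE]; first by rewrite mul0r.
  by case: sj; apply: val_inj; rewrite /= sE (uE j' j).
left; exists (fun y => if fintype.split (s (lshift b y)) is inl z then z else y) => // y.
case: fintype.splitP => [z zE|j sE]; first by apply: val_inj.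
have : s (lshift b y) = s (uix j) by rewrite su; apply: val_inj.
move/perm_inj => /(congr1 val) /=; have := ltn_ord y; lia.
Qed.

(** The unpaired index is fixed, so the paired ones stay among themselves and see only the upper
    left block. *)
Lemma AltM_isU (S : comNzRingType) (A B : 'M[S]_k) : ulsubmx A = ulsubmx B ->
  AltM A (isU S) = AltM B (isU S).
Proof.
move=> AB; apply: eq_bigr => s _; congr (_ * _).
have [[r sr _]|->] := prod_isU S s; last by rewrite !mulr0.
congr (_ * _); apply: eq_bigr => i _; rewrite !sr.
by have /matrixP/(_ (r (lshift w i)) (r (rshift w i))) := AB; rewrite !mxE.
Qed.

Definition Jmx (S : comNzRingType) : 'M[S]_k :=
  block_mx (block_mx 0 1%:M (- 1%:M) 0) 0 0 0.

(** Congruence by the block diagonal [G] with blocks 1, [M^T], 1 carries the standard pairing [Jmx]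
    to [A] on the paired indices and fixes [isU]. *)
Lemma AltM_block (S : comNzRingType) (A : 'M[S]_k) (M : 'M[S]_w) :
  ulsubmx A = block_mx 0 M (- M^T) 0 -> AltM A (isU S) = \det M * AltM (Jmx S) (isU S).
Proof.
move=> AM; pose G := block_mx (block_mx 1%:M 0 0 M^T) 0 0 1%:M : 'M[S]_k.
have detG : \det G = \det M by rewrite det_ublock det_ublock !det1 det_tr mul1r mulr1.
rewrite -detG -AltM_congr.
transitivity (AltM (G *m Jmx S *m G^T) (isU S)).
  apply: AltM_isU; rewrite AM /G /Jmx !tr_block_mx !mulmx_block block_mxKul.
  by rewrite ?(trmx0, trmx1, trmxK, mul0mx, mulmx0, mul1mx, mulmx1, addr0, add0r, mulmx_block,
    mulmxN, mulNmx, tr_block_mx).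
apply: eq_bigr => s _; congr (_ * (_ * _)); apply: eq_bigr => j _.
rewrite big_split_ord /= big1 ?add0r => [|y _]; last by rewrite isU_l mulr0.
under eq_bigr do rewrite isU_u mulr1.
rewrite -[s _]splitK; case: (fintype.split _) => y /=.
  by rewrite isU_l big1 // => j' _; rewrite block_mxEur mxE.
rewrite isU_u (bigD1 y) //= block_mxEdr mxE eqxx big1 ?addr0 // => j' ne.
by rewrite block_mxEdr mxE eq_sym (negbTE ne).
Qed.

Lemma det_block_sym (S : comNzRingType) n (A B : 'M[S]_n) :
  \det (block_mx A B B A) = \det (A + B) * \det (A - B).
Proof.
have -> : \det (block_mx A B B A) = \det (block_mx 1%:M 1%:M 0 1%:M *m block_mx A B B A *m
    block_mx 1%:M (- 1%:M) 0 1%:M).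
  by rewrite !det_mulmx !det_ublock !det1 !mulr1 mul1r.
rewrite !mulmx_block !mul0mx !mul1mx !mulmx0 !mulmx1 !mulmxN !mulmx1 !add0r !addr0.
rewrite (_ : - (A + B) + (B + A) = 0) ?[B + A]addrC ?addNr // det_lblock; congr (_ * \det _).
by rewrite addrC.
Qed.

Local Notation JZ := (Jmx int).

Lemma JZ_ll i j : JZ (lix i) (lix j) = 0.
Proof. by rewrite block_mxEul block_mxEul mxE. Qed.
Lemma JZ_rr i j : JZ (rix i) (rix j) = 0.
Proof. by rewrite block_mxEul block_mxEdr mxE. Qed.
Lemma JZ_lr i j : JZ (lix i) (rix j) = (i == j)%:R.
Proof. by rewrite block_mxEul block_mxEur mxE. Qed.
Lemma JZ_rl i j : JZ (rix i) (lix j) = - (i == j)%:R.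
Proof. by rewrite block_mxEul block_mxEdl !mxE. Qed.

Lemma lix_inj : injective lix. Proof. by move=> i j /lshift_inj/lshift_inj. Qed.
Lemma rix_inj : injective rix. Proof. by move=> i j /lshift_inj/rshift_inj. Qed.
Lemma lix_rix i j : (lix i == rix j) = false.
Proof. by apply/negP => /eqP/lshift_inj/eqP; rewrite eq_lrshift. Qed.

Lemma ixP (y : 'I_(w + w)) : (exists i, lshift b y = lix i) \/ (exists i, lshift b y = rix i).
Proof. by rewrite -[y]splitK; case: (fintype.split y) => i; [left|right]; exists i. Qed.

(* A permutation that contributes preserves the matching of the indices [lix i] and [rix i],
   so its matrix has the form treated in [det_block_sym], with [A - B] obtained from [A + B]
   by changing the signs of rows. *)
Lemma AltM_term_ge0 (s : 'S_k) :
  0 <= (-1) ^+ s * ((\prod_i JZ (s (lix i)) (s (rix i))) * \prod_j isU int (s (uix j))).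
Proof.
have [[r sr su]|->] := prod_isU int s; last by rewrite !mulr0.
rewrite [X in _ * (_ * X)]big1 ?mulr1 => [|j _]; last by rewrite su isU_u.
pose c i := JZ (s (lix i)) (s (rix i)).
have [c0|/existsNP[i /contrapT ci]] := pselect (forall i, c i <> 0); last first.
  by rewrite (bigD1 i) //= -/(c i) ci mul0r mulr0.
pose A := \matrix_(i < w, j < w) ((s (lix i) == lix j)%:R : int).
pose B := \matrix_(i < w, j < w) ((s (lix i) == rix j)%:R : int).
have cP i : (exists j, [/\ s (lix i) = lix j, s (rix i) = rix j & c i = 1]) \/
            (exists j, [/\ s (lix i) = rix j, s (rix i) = lix j & c i = -1]).
  have := c0 i; rewrite /c !sr.
  have [[x ->]|[x ->]] := ixP (r (lshift w i)); have [[y ->]|[y ->]] := ixP (r (rshift w i)).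
  - by rewrite JZ_ll.
  - by rewrite JZ_lr; case: eqP => // -> _; left; exists y.
  - by rewrite JZ_rl; case: eqP => // -> _; right; exists y.
  - by rewrite JZ_rr.
have sgnE : (-1) ^+ s = \det (block_mx A B B A) :> int.
  rewrite -det_perm -[perm_mx s]submxK (_ : ulsubmx _ = block_mx A B B A); last first.
    apply/matrixP => x y; rewrite -[x]splitK -[y]splitK.
    case: (fintype.split x) => i; case: (fintype.split y) => j;
      rewrite ?block_mxEul ?block_mxEur ?block_mxEdl ?block_mxEdr !mxE /= -/(lix _) -/(rix _) //;
      rewrite -/(lix _) -/(rix _); have [[z [sl sr' _]]|[z [sl sr' _]]] := cP i;
      by rewrite sl sr' ?lix_rix ?(eq_sym (rix _) (lix _)) ?lix_rix ?(inj_eq lix_inj) ?(inj_eq rix_inj).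
  rewrite (_ : drsubmx _ = 1%:M); last first.
    by apply/matrixP => i j; rewrite !mxE -/(uix i) su /uix eq_rshift.
  rewrite (_ : ursubmx _ = 0) ?det_lblock ?det1 ?mulr1 //.
  by apply/matrixP => x j; rewrite !mxE sr eq_lrshift.
have AB : A - B = diag_mx (\row_i c i) *m (A + B).
  apply/matrixP => i j; rewrite mul_diag_mx !mxE.
  by have [[z [-> _ ->]]|[z [-> _ ->]]] := cP i; rewrite ?lix_rix ?(eq_sym (rix _) (lix _)) ?lix_rix
    ?(subr0, sub0r, addr0, add0r, mul1r, mulN1r).
rewrite sgnE det_block_sym AB det_mulmx det_diag.
rewrite (eq_bigr c) => [|i _]; last by rewrite mxE.
(* By [AB] the sign is the square of [\det (A + B)] times the product of the [c i], so the whole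
   term is a square. *)
rewrite (_ : _ * _ = (\det (A + B) * \prod_i c i) ^+ 2) ?sqr_ge0 //.
by move: (\det _) (\prod_i c i) => x y; ring.
Qed.

(** The identity contributes 1 and no term is negative. Positivity is what permits cancelling this
    constant at the end. *)
Lemma AltM_JZ_gt0 : 0 < AltM JZ (isU int).
Proof.
rewrite /AltM (bigD1 (perm_one _)) //= odd_perm1 expr0 mul1r.
rewrite [X in X * _]big1 => [|i _]; last by rewrite !perm1 JZ_lr eqxx.
rewrite [X in 1 * X]big1 => [|j _]; last by rewrite perm1 isU_u.
by rewrite ltr_wpDr // sumr_ge0 // => s _; apply: AltM_term_ge0.
Qed.

Lemma AltM_Jmx (S : comNzRingType) : AltM (Jmx S) (isU S) = (AltM JZ (isU int))%:~R.
Proof.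
rewrite rmorph_sum; apply: eq_bigr => s _.
rewrite !rmorphM rmorph_sign !rmorph_prod; congr (_ * (_ * _)); apply: eq_bigr => i _ /=.
  rewrite -[Jmx S](_ : map_mx (fun z : int => z%:~R) JZ = _) ?mxE //.
  by rewrite /Jmx !map_block_mx !map_mx0 map_mxN map_mx1.
by rewrite /isU; case: fintype.split.
Qed.

End Pfaffian.

(** * Toeplitz forms on polynomials and the change of basis *)

Section Toeplitz.
Variables (S : comNzRingType) (u : nat -> int -> S).
Hypothesis u_step : forall n d, u n.+1 d = u n (d - 1) + u n (d + 1).
Implicit Types (p q : {poly int}) (g h : nat -> S).

(** The linear functional sending ['X^a] to [g a]: polynomials serve as vectors, so that shifts of
    indices become multiplications. *)
Definition ev p g : S := \sum_(a < size p) (p`_a)%:~R * g a.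

Lemma ev_wide N p g : (size p <= N)%N -> ev p g = \sum_(a < N) (p`_a)%:~R * g a.
Proof.
move=> pN; rewrite /ev -!(big_mkord xpredT (fun a => (p`_a)%:~R * g a)).
rewrite [RHS](@big_cat_nat _ _ _ (size p)) //= [X in _ = _ + X]big1_seq ?addr0 // => a.
by rewrite mem_index_iota => /andP[_ /andP[pa _]]; rewrite nth_default // mul0r.
Qed.

Lemma eq_ev p g h : g =1 h -> ev p g = ev p h.
Proof. by move=> gh; apply: eq_bigr => a _; rewrite gh. Qed.

Lemma evD p q g : ev (p + q) g = ev p g + ev q g.
Proof.
pose N := maxn (size p) (size q).
rewrite (@ev_wide N) ?size_polyD // (@ev_wide N p) ?leq_maxl // (@ev_wide N q) ?leq_maxr //.
by rewrite -big_split; apply: eq_bigr => a _; rewrite coefD rmorphD mulrDl.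
Qed.

Lemma evN p g : ev (- p) g = - ev p g.
Proof. by rewrite /ev size_polyN -sumrN; apply: eq_bigr => a _; rewrite coefN rmorphN mulNr. Qed.

Lemma ev_add p g h : ev p (fun a => g a + h a) = ev p g + ev p h.
Proof. by rewrite -big_split; apply: eq_bigr => a _; rewrite mulrDr. Qed.

Lemma evX p g : ev (p * 'X) g = ev p (fun a => g a.+1).
Proof.
rewrite (@ev_wide (size p).+1); last by rewrite (leq_trans (size_polyMleq _ _)) // size_polyX addn2.
rewrite big_ord_recl coefMX /= mul0r add0r; apply: eq_bigr => a _.
by rewrite coefMX.
Qed.

Lemma ev1 g : ev 1 g = g 0%N.
Proof. by rewrite /ev size_poly1 big_ord1 coef1 mul1r. Qed.

Definition bform n p q : S := ev p (fun a => ev q (fun c => u n (c%:Z - a%:Z))).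

Lemma bformXX n p q : bform n (p * 'X) (q * 'X) = bform n p q.
Proof.
by rewrite /bform evX; apply: eq_ev => a; rewrite evX; apply: eq_ev => c; congr (u n _); lia.
Qed.

Local Notation Y := (1 + 'X * 'X).

Lemma evY p g : ev (p * Y) g = ev p (fun a => g a + g a.+2).
Proof. by rewrite mulrDr mulr1 mulrA evD !evX -ev_add. Qed.

(** Relative to ['X], the polynomial [Y] acts as ['X] plus its inverse, which is the step from [n]
    to [n + 1] in [u_step]. *)
Lemma bformYX n p q : bform n (p * Y) (q * 'X) = bform n.+1 p q.
Proof.
rewrite /bform evY; apply: eq_ev => a; rewrite !evX -ev_add; apply: eq_ev => c.
by rewrite u_step addrC; congr (u n _ + u n _); lia.
Qed.

Lemma bformXY n p q : bform n (p * 'X) (q * Y) = bform n.+1 p q.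
Proof.
rewrite /bform evX; apply: eq_ev => a; rewrite !evY; apply: eq_ev => c.
by rewrite u_step; congr (u n _ + u n _); lia.
Qed.

Lemma bformYY n p q : bform n (p * Y) (q * Y) = bform n.+2 p q.
Proof.
rewrite /bform evY; apply: eq_ev => a; rewrite !evY -ev_add; apply: eq_ev => c.
rewrite !u_step; set d := c%:Z - a%:Z.
have -> : c.+2%:Z - a%:Z = d + 1 + 1 by rewrite /d; lia.
have -> : c%:Z - a.+2%:Z = d - 1 - 1 by rewrite /d; lia.
have -> : c.+2%:Z - a.+2%:Z = d by rewrite /d; lia.
have -> : d - 1 + 1 = d by lia.
have -> : d + 1 - 1 = d by lia.
by ring.
Qed.

(** The balance of exponents lets factors be cancelled in pairs, one from each side; each cancelled
    [Y] raises the order by one. *)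
Lemma bform_reduce n p q i j c d : (i + c = j + d)%N ->
  bform n (p * Y ^+ i * 'X^c) (q * Y ^+ j * 'X^d) = bform (n + i + j) p q.
Proof.
have YS (r : {poly int}) e f : r * Y ^+ e.+1 * 'X^f = r * Y ^+ e * 'X^f * Y.
  by rewrite exprSr mulrA mulrAC.
have XS (r : {poly int}) e f : r * Y ^+ e * 'X^(f.+1) = r * Y ^+ e * 'X^f * 'X.
  by rewrite [in LHS]exprSr mulrA.
have [m] := ubnP (i + c)%N; elim: m n i j c d => // m IH n i j c d icm icjd.
case: c d icm icjd => [|c] [|d] icm icjd.
- case: i j icm icjd => [|i] [|j] icm icjd; [|lia|lia|].
    by rewrite !expr0 !mulr1 !addn0.
  by rewrite !YS bformYY IH; try lia; congr bform; lia.
- case: i icm icjd => [|i] icm icjd; first by lia.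
  by rewrite YS XS bformYX IH; try lia; congr bform; lia.
- case: j icjd => [|j] icjd; first by lia.
  by rewrite YS XS bformXY IH; try lia; congr bform; lia.
- by rewrite !XS bformXX IH; try lia; congr bform; lia.
Qed.

Lemma ev_horner1 p : ev p (fun=> 1) = (p.[1])%:~R.
Proof.
rewrite horner_coef rmorph_sum; apply: eq_bigr => a _.
by rewrite expr1n !mulr1.
Qed.

Variables (w b : nat) (p1 p2 : {poly int}).
Hypotheses (b1 : (b <= 1)%N) (size_p1 : (size p1 <= b.+2)%N) (size_p2 : (size p2 <= b.+2)%N).
Hypotheses (p1_1 : (0 < b)%N -> p1.[1] = 0) (p2_1 : (0 < b)%N -> p2.[1] = 0).
Hypotheses (p11 : forall n, bform n p1 p1 = 0) (p22 : forall n, bform n p2 p2 = 0).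
Hypothesis p21 : forall n, bform n p2 p1 = - bform n p1 p2.

Local Notation k := (w + w + b)%N.

(** The exponents of [Y] and ['X] beside [p1] or [p2] add up to [w - 1], so [bform_reduce] applies
    to every such pair and gives entries depending on [i + j]. For [b = 1], [p1] and [p2] vanish at
    1 while ['X^w] takes the value 1, which turns the all-ones vector into [isU]. *)
Definition pol (x : 'I_k) : {poly int} :=
  match fintype.split x with
  | inl y => match fintype.split y with
    | inl i => p1 * Y ^+ i * 'X^(w.-1 - i)
    | inr i => p2 * Y ^+ i * 'X^(w.-1 - i)
    end
  | inr j => 'X^w
  end.

Lemma pol_lix i : pol (lix b i) = p1 * Y ^+ i * 'X^(w.-1 - i).
Proof. by rewrite /pol /lix (unsplitK (inl _)) (unsplitK (inl i)). Qed.

Lemma pol_rix i : pol (rix b i) = p2 * Y ^+ i * 'X^(w.-1 - i).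
Proof. by rewrite /pol /rix (unsplitK (inl _)) (unsplitK (inr i)). Qed.

Lemma pol_uix j : pol (uix w j) = 'X^w.
Proof. by rewrite /pol /uix (unsplitK (inr j)). Qed.

Lemma size_pol x : (size (pol x) <= k)%N.
Proof.
have szY1 : (size (Y : {poly int}) <= 3)%N.
  by apply: leq_trans (size_polyD _ _) _; rewrite size_poly1 geq_max /= -expr2 size_polyXn.
have szY i : (size (Y ^+ i : {poly int}) <= (2 * i).+1)%N.
  apply: leq_trans (size_poly_exp_leq _ _) _; rewrite ltnS leq_mul2r; apply/orP; right; lia.
have sz p (i : 'I_w) : (size p <= b.+2)%N -> (size (p * Y ^+ i * 'X^(w.-1 - i))%R <= k)%N.
  move=> pb; apply: leq_trans (size_polyMleq _ _) _; rewrite size_polyXn addnS /=.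
  have h1 := size_polyMleq p (Y ^+ i); have h2 := szY i; have h3 := ltn_ord i.
  by move: (size (p * _)) (size (Y ^+ i)) h1 h2 => B C h1 h2; lia.
rewrite -[x]splitK; case: (fintype.split x) => [y|j] /=.
  rewrite -[y]splitK; case: (fintype.split y) => i /=.
    by rewrite pol_lix sz.
  by rewrite pol_rix sz.
by rewrite pol_uix size_polyXn; have := ltn_ord j; lia.
Qed.

Lemma AltM_eps (A : 'M[S]_k) (e f : 'I_k -> S) :
  ((0 < b)%N -> e =1 f) -> AltM A e = AltM A f.
Proof.
move=> ef; apply: eq_bigr => s _; congr (_ * (_ * _)); apply: eq_bigr => j _.
by apply: ef; apply: leq_ltn_trans (ltn_ord j).
Qed.

Definition polmx : 'M[int]_k := \matrix_(x, y) (pol x)`_y.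

Lemma AltM_toeplitz :
  (\det polmx)%:~R * AltM (\matrix_(x < k, y < k) u 0 (y%:Z - x%:Z)) (fun=> 1) =
  \det (\matrix_(i < w, j < w) bform (i + j) p1 p2) * (AltM (Jmx w b int) (isU int))%:~R.
Proof.
rewrite -AltM_Jmx -det_map_mx -AltM_congr.
rewrite (@AltM_eps _ _ (isU S)) => [|b0 x]; last first.
  transitivity (ev (pol x) (fun=> 1)).
    by rewrite (ev_wide _ (size_pol x)); apply: eq_bigr => y _; rewrite !mxE.
  rewrite ev_horner1 -[x]splitK; case: (fintype.split x) => [y|j] /=.
    rewrite isU_l -[y]splitK; case: (fintype.split y) => i /=.
      by rewrite pol_lix !hornerM p1_1 // !mul0r.
    by rewrite pol_rix !hornerM p2_1 // !mul0r.
  by rewrite pol_uix isU_u hornerXn expr1n.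
apply: AltM_block => //; set A := _ *m _.
have AE x y : A x y = bform 0 (pol x) (pol y).
  rewrite /A mxE /bform (ev_wide _ (size_pol x)).
  under eq_bigr => z _ do rewrite !mxE mulr_suml.
  rewrite exchange_big /=; apply: eq_bigr => z _.
  rewrite (ev_wide _ (size_pol y)) mulr_sumr; apply: eq_bigr => z' _; rewrite !mxE.
  by rewrite mulrAC -mulrA.
clearbody A; have red (p q : {poly int}) (i j : 'I_w) :
    bform 0 (p * Y ^+ i * 'X^(w.-1 - i)) (q * Y ^+ j * 'X^(w.-1 - j)) = bform (i + j) p q.
  by rewrite bform_reduce ?add0n //; have := ltn_ord i; have := ltn_ord j; lia.
rewrite -[ulsubmx A]submxK; congr block_mx; apply/matrixP => i j; rewrite !mxE AE.
- by rewrite pol_lix pol_lix red p11.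
- by rewrite pol_lix pol_rix red.
- by rewrite pol_rix pol_lix red p21 addnC.
- by rewrite pol_rix pol_rix red p22.
Qed.

End Toeplitz.

(** * Hankel determinants and walks on a half-line *)

Section Hankel.
Variable loop : nat.

(* The number of walks of length [i] from [0] to [d] on the half-line, with [loop] loops at [0]. *)
Fixpoint walks (i d : nat) : nat :=
  if i is i'.+1 then
    if d is d'.+1 then walks i' d' + walks i' d'.+2 else loop * walks i' 0 + walks i' 1
  else (d == 0).

Lemma walks_oob i d : (i < d)%N -> walks i d = 0%N.
Proof. by elim: i d => [|i IH] [|d] //= id; rewrite !IH //; lia. Qed.

Lemma walks_diag i : walks i i = 1%N.
Proof. by elim: i => //= i ->; rewrite walks_oob. Qed.

(** One step of the walk is a self-adjoint operator, the loops being diagonal; the bounds on [i] and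
    [j] make the boundary terms of the truncation vanish. *)
Lemma walks_shift W i j : (i < W)%N -> (j < W)%N ->
  (\sum_(d < W.+1) walks i.+1 d * walks j d = \sum_(d < W.+1) walks i d * walks j.+1 d)%N.
Proof.
move=> iW jW; rewrite !big_ord_recl /=.
rewrite (eq_bigr (fun d : 'I_W => walks i d * walks j d.+1 + walks i d.+2 * walks j d.+1)%N); last first.
  by move=> d _; rewrite /= mulnDl.
rewrite [X in _ = (_ + X)%N](eq_bigr
  (fun d : 'I_W => walks i d.+1 * walks j d + walks i d.+1 * walks j d.+2)%N); last first.
  by move=> d _; rewrite /= mulnDr.
rewrite !big_split /=.
have shift a c : (\sum_(d < W) walks a d.+1 * walks c d = walks a 1 * walks c 0 +
    \sum_(d < W) walks a d.+2 * walks c d.+1)%N \/ (W <= a)%N.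
  have [Wa|aW] := leqP W a; [by right|left].
  case: W aW {iW jW} => // W aW; rewrite big_ord_recl [X in _ = (_ + X)%N]big_ord_recr /=.
  by rewrite [walks a W.+2]walks_oob ?addn0 // ltnW.
have [s1|] := shift i j; last by rewrite leqNgt iW.
have [s2|] := shift j i; last by rewrite leqNgt jW.
have swap a c (f g : nat -> nat) : (\sum_(d < W) walks a (f d) * walks c (g d) =
    \sum_(d < W) walks c (g d) * walks a (f d))%N.
  by apply: eq_bigr => d _; rewrite mulnC.
rewrite (swap i j id succn) s2 s1 (swap i j succn (fun d => d.+2)); ring.
Qed.

Lemma walks_add W i j : (i + j < W)%N ->
  (\sum_(d < W) walks i d * walks j d = walks (i + j) 0)%N.
Proof.
case: W => // W; elim: i j => [|i IH] j ijW.
  by rewrite big_ord_recl /= mul1n big1 ?addn0.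
by rewrite walks_shift ?IH ?addSnnS //; lia.
Qed.

Lemma walks_mul W i j : (i < W)%N -> (\sum_(d < W) walks i d * walks j d = walks (i + j) 0)%N.
Proof.
(* [walks_add] asks for a range beyond [i + j]; the added terms vanish because a walk of length [i]
   does not reach [W]. *)
move=> iW; rewrite -(@walks_add (W + (i + j).+1)) ?leq_addl // big_split_ord /=.
by rewrite [X in _ = (_ + X)%N]big1 ?addn0 // => d _; rewrite walks_oob // ltn_addr.
Qed.

(** Cutting walks of length [i + j] after [i] steps factors the matrix as [N *m N^T] with [N] lower
    unitriangular. *)
Lemma det_walks (R : comNzRingType) w : \det (\matrix_(i < w, j < w) (walks (i + j) 0)%:R) = 1 :> R.
Proof.
pose N := \matrix_(i < w, d < w) (walks i d)%:R : 'M[R]_w.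
have -> : \matrix_(i < w, j < w) (walks (i + j) 0)%:R = N *m N^T.
  apply/matrixP => i j; rewrite !mxE -(walks_mul _ (ltn_ord i)) natr_sum.
  by apply: eq_bigr => d _; rewrite !mxE natrM.
rewrite det_mulmx det_tr det_trig; last first.
  by apply/is_trig_mxP => i j ij; rewrite mxE walks_oob.
by rewrite big1 ?mulr1 // => i _; rewrite mxE walks_diag.
Qed.

Variables (R : comNzRingType) (v : nat -> fps R).
Hypotheses (v0 : pskew (v 0) = v 0 *+ loop + v 1).
Hypothesis (vS : forall d, pskew (v d.+1) = v d + v d.+2).
Hypotheses (v0_coef0 : coef0 (v 0) = 1) (vS_coef0 : forall d, coef0 (v d.+1) = 0).

Lemma iter_pskewD n (F G : fps R) :
  iter n (@pskew R) (F + G) = iter n (@pskew R) F + iter n (@pskew R) G.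
Proof. by elim: n => //= n ->. Qed.

Lemma iter_pskewN n (F : fps R) : iter n (@pskew R) (- F) = - iter n (@pskew R) F.
Proof. by elim: n => //= n ->. Qed.

Lemma iter_pskewMn n (F : fps R) m : iter n (@pskew R) (F *+ m) = iter n (@pskew R) F *+ m.
Proof.
elim: m => [|m IH]; last by rewrite !mulrS iter_pskewD IH.
by rewrite !mulr0n; elim: n => //= n ->.
Qed.

(** [pskew] acts on the [v d] by one step of the walk, and only [v 0] has a nonzero constant
    term. *)
Lemma coef0_iter_pskew n d : coef0 (iter n (@pskew R) (v d)) = (walks n d)%:R.
Proof.
elim: n d => [|n IH] [|d]; rewrite ?iterSr /= ?v0_coef0 ?vS_coef0 //.
  by rewrite v0 iter_pskewD iter_pskewMn rmorphD rmorphMn /= !IH natrD natrM mulr_natl.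
by rewrite vS iter_pskewD rmorphD /= !IH natrD.
Qed.

Lemma coef0_det_hankel w : coef0 (\det (\matrix_(i < w, j < w) iter (i + j) (@pskew R) (v 0))) = 1.
Proof.
rewrite -det_map_mx -[RHS](det_walks R w); congr (\det _); apply/matrixP => i j.
by rewrite !mxE; apply: coef0_iter_pskew.
Qed.

End Hankel.

(** * Cancellation of the constants, over the rationals *)

Section Final.
Let R : comNzRingType := rat.

Lemma pskew_qser d : pskew (qser R d) = qser R (d - 1) + qser R (d + 1).
Proof. by apply: (@pskew_rec _ _ (qser R d)) => P v nPv; rewrite qser_rec. Qed.

Let u n d : fps R := iter n (@pskew R) (qser R d).

Lemma u_step n d : u n.+1 d = u n (d - 1) + u n (d + 1).
Proof. by rewrite /u iterSr pskew_qser iter_pskewD. Qed.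

Lemma uN n d : u n (- d) = - u n d.
Proof. by rewrite /u qserN iter_pskewN. Qed.

(** [main] relates the alternating sum to the Hankel determinant and [Alt_qprod_bounded] relates it
    to the Schur sum. Constant terms in [main] show that the two unknown factors, [dP] and
    [coef0 al], multiply to the nonzero [K]. *)
Lemma bounded_schur_sum w b (p1 p2 : {poly int}) loop (v : nat -> fps R) : (b <= 1)%N ->
  (size p1 <= b.+2)%N -> (size p2 <= b.+2)%N ->
  ((0 < b)%N -> p1.[1] = 0) -> ((0 < b)%N -> p2.[1] = 0) ->
  (forall n, bform u n p1 p1 = 0) -> (forall n, bform u n p2 p2 = 0) ->
  (forall n, bform u n p2 p1 = - bform u n p1 p2) ->
  (forall n, bform u n p1 p2 = 2%:R * iter n (@pskew R) (v 0)) ->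
  pskew (v 0) = v 0 *+ loop + v 1 -> (forall d, pskew (v d.+1) = v d + v d.+2) ->
  coef0 (v 0) = 1 -> (forall d, coef0 (v d.+1) = 0) ->
  fsum [set la | is_part la /\ (head 0 la <= w + w + b)%N] schur =
  esum ^+ b * \det (\matrix_(i < w, j < w) iter (i + j) (@pskew R) (v 0)).
Proof.
move=> b1 s1 s2 e1 e2 p11 p22 p21 p12 v0 vS c0 cS.
set H := \matrix_(i, j) _.
have top := AltM_toeplitz u_step w b1 s1 s2 e1 e2 p11 p22 p21.
set C := AltM (Jmx w b int) (isU int) in top; set dP := \det _ in top.
have Cgt0 : 0 < C := AltM_JZ_gt0 w b1.
have detH : \det (\matrix_(i < w, j < w) bform u (i + j) p1 p2) = ((2 ^ w)%N : int)%:~R * \det H.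
  rewrite (_ : \matrix_(i, j) _ = 2%:R *: H); last by apply/matrixP => i j; rewrite !mxE p12.
  by rewrite detZ -natrX -pmulrn.
pose al := Alt (@qprod R w b) (heights (fun=> 0%N)).
have alE : al = esum ^+ b * AltM (\matrix_(x < w + w + b, y < w + w + b) u 0 (y%:Z - x%:Z)) (fun=> 1).
  rewrite /al /Alt mulr_sumr; apply: eq_bigr => s _; rewrite /qprod [RHS]mulrCA; congr (_ * _).
  rewrite [X in _ = _ * (_ * X)]big1 // mulr1 mulrC; congr (_ * _); apply: eq_bigr => i _.
  by rewrite mxE /u /=; congr (qser R _); rewrite /heights; lia.
(* [C] comes from the standard pairing, [2 ^ w] from the factor 2 in the entries of the off-diagonal
   block. *)
pose K : int := C * (2 ^ w)%N.
have main : dP%:~R * al = K%:~R * (esum ^+ b * \det H).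
  by rewrite alE mulrCA top detH /K rmorphM /=; ring.
have K0 : K%:~R != 0 :> R by rewrite intr_eq0 gt_eqF // mulr_gt0 // ltz_nat expn_gt0.
have const : dP%:~R * coef0 al = K%:~R.
  have := congr1 (@coef0 R) main; rewrite !rmorphM !rmorph_int rmorphXn /= coef0_esum expr1n mul1r.
  by rewrite (coef0_det_hankel v0 vS c0 cS) mulr1.
apply/funext => m; apply: (mulfI K0); rewrite -[RHS]fps_mulzE -main [RHS]fps_mulzE.
by rewrite /al Alt_qprod_bounded -/al mulrA const.
Qed.

End Final.

(** Symmetry is carried along because [skewing psum1] is known to be [pskew] on symmetric series
    only. *)
Lemma iter_skewing_psum1 (R : comNzRingType) n (F : fps R) : sym_series F ->
  iter n (skewing psum1) F = iter n (@pskew R) F /\ sym_series (iter n (@pskew R) F).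
Proof.
move=> sF; elim: n => //= n [-> sn].
by split; [apply: skewing_psum1|apply: sym_pskew].
Qed.

(** * The polynomials for even and odd bounds *)

Section SmallForms.
Variables (S : comNzRingType) (u : nat -> int -> S).
Hypotheses (uN : forall n d, u n (- d) = - u n d) (u0 : forall n, u n 0 = 0).

Let diffE : (((0%:Z - 0%:Z = 0) * (1%:Z - 1%:Z = 0) * (2%:Z - 2%:Z = 0)) *
  ((0%:Z - 1%:Z = - 1) * (0%:Z - 2%:Z = - 2) * (1%:Z - 2%:Z = - 1)) *
  ((1%:Z - 0%:Z = 1) * (2%:Z - 0%:Z = 2) * (2%:Z - 1%:Z = 1)))%type.
Proof. by []. Qed.

(** The explicit factor 1 lets [evX] and [ev1] evaluate these polynomials by rewriting. *)
Definition pE1 : {poly int} := 1 * 'X + 1.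
Definition pE2 : {poly int} := 1 * 'X - 1.
(** The even pair multiplied by ['X - 1], since the odd case requires polynomials that vanish at
    1. *)
Definition pO1 : {poly int} := 1 * 'X * 'X - 1.
Definition pO2 : {poly int} := 1 * 'X * 'X - 1 * 'X - 1 * 'X + 1.

Lemma bform_even n : [/\ bform u n pE1 pE1 = 0, bform u n pE2 pE2 = 0,
  bform u n pE1 pE2 = 2%:R * u n 1 & bform u n pE2 pE1 = - (2%:R * u n 1)].
Proof. by split; rewrite /bform /pE1 /pE2 !(evD, evN, evX, ev1) !diffE !uN !u0; ring. Qed.

Lemma bform_odd n : [/\ bform u n pO1 pO1 = 0, bform u n pO2 pO2 = 0,
  bform u n pO1 pO2 = 2%:R * (2%:R * u n 1 - u n 2)
  & bform u n pO2 pO1 = - (2%:R * (2%:R * u n 1 - u n 2))].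
Proof. by split; rewrite /bform /pO1 /pO2 !(evD, evN, evX, ev1) !diffE ?uN ?u0; ring. Qed.

Lemma size_pE : (size pE1 <= 2)%N /\ (size pE2 <= 2)%N.
Proof.
by rewrite /pE1 /pE2 mul1r; split; apply: leq_trans (size_polyD _ _) _;
  rewrite geq_max ?size_polyN size_polyX size_poly1.
Qed.

Lemma size_pO : (size pO1 <= 3)%N /\ (size pO2 <= 3)%N.
Proof.
have size_XX : (size ('X * 'X : {poly int})%R <= 3)%N by rewrite -expr2 size_polyXn.
have szD (p q : {poly int}) : (size p <= 3)%N -> (size q <= 3)%N -> (size (p + q)%R <= 3)%N.
  by move=> p3 q3; apply: leq_trans (size_polyD _ _) _; rewrite geq_max p3.
by rewrite /pO1 /pO2 !mul1r; split; do !apply: (szD);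
  rewrite ?size_polyN ?size_polyX ?size_poly1 //.
Qed.

End SmallForms.

Theorem theorem1p4 (w : nat) :
  (fsum [set la | is_part la /\ (head 0 la <= 2 * w + 1)%N] schur
   = esum * \det (\matrix_(i < w, j < w)
                    iter (i + j)%N (skewing psum1) (fser 0 - fser 2)) :> fps rat)
  /\
  (fsum [set la | is_part la /\ (head 0 la <= 2 * w)%N] schur
   = \det (\matrix_(i < w, j < w)
             iter (i + j)%N (skewing psum1) (fser 0 + fser 1)) :> fps rat).
Proof.
pose u n d : fps rat := iter n (@pskew rat) (qser rat d).
have uN n d : u n (- d) = - u n d by rewrite /u qserN iter_pskewN.
have u0 n : u n 0 = 0 by rewrite /u qser0; elim: n => //= n ->.
have q1 : qser rat 1 = fser 0 + fser 1 by have := qserS rat 0; rewrite qser0 !add0r.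
have q2 : qser rat 2 = qser rat 1 + (fser 1 + fser 2) by apply: (qserS rat 1).
have skewE F : sym_series F -> \matrix_(i < w, j < w) iter (i + j)%N (skewing psum1) F =
    \matrix_(i < w, j < w) iter (i + j)%N (@pskew rat) F.
  by move=> sF; apply/matrixP => i j; rewrite !mxE (iter_skewing_psum1 (i + j) sF).1.
split.
- pose v d : fps rat := fser d%:Z - fser (d%:Z + 2).
  have symv : sym_series (v 0%N) by apply: symD; [|apply: symN]; apply: sym_fser.
  have -> : fser 0 - fser 2 = v 0%N by [].
  rewrite skewE // -[esum]expr1.
  have -> : (2 * w + 1 = w + w + 1)%N by rewrite mul2n addnn.
  have [s1 s2] := size_pO; have bf n := bform_odd uN u0 n.
  (* No loop: [pskew (v 0)] is f_(-1) + f_1 - f_1 - f_3 = f_1 - f_3, which is [v 1]. *)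
  apply: (@bounded_schur_sum w 1 pO1 pO2 0 v) => //.
  + by move=> _; rewrite /pO1 !hornerE.
  + by move=> _; rewrite /pO2 !hornerE.
  + by move=> n; case: (bf n).
  + by move=> n; case: (bf n).
  + by move=> n; case: (bf n) => _ _ -> ->.
  + move=> n; case: (bf n) => _ _ -> _; congr (_ * _).
    (* 2 q_1 - q_2 = q_1 - (f_1 + f_2) = f_0 - f_2. *)
    rewrite mulr_natl mulr2n /u q2 q1 -!iter_pskewD -iter_pskewN -iter_pskewD; congr iter.
    rewrite /v add0r; ring.
  + rewrite mulr0n add0r /v pskewD pskewN !pskew_fser !sub0r !add0r.
    have -> : (2 - 1 : int) = 1 by [].
    rewrite fserN; have -> : (2 + 1 : int) = 1 + 2 by [].
    ring.
  + move=> d; rewrite /v pskewD pskewN !pskew_fser.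
    have -> : d.+1%:Z - 1 = d%:Z by lia.
    have -> : d.+1%:Z + 2 - 1 = d%:Z + 2 by lia.
    have -> : d.+1%:Z + 1 = d.+2%:Z by lia.
    have -> : d.+1%:Z + 2 + 1 = d.+2%:Z + 2 by lia.
    ring.
  + by rewrite rmorphB /= !coef0_fser subr0.
  + by move=> d; rewrite rmorphB /= !coef0_fser subr0.
pose v d : fps rat := fser d%:Z + fser (d%:Z + 1).
have symv : sym_series (v 0%N) by apply: symD; apply: sym_fser.
have -> : fser 0 + fser 1 = v 0%N by [].
rewrite skewE // -[RHS]mul1r -[X in X * _](expr0 esum).
have -> : (2 * w = w + w + 0)%N by rewrite mul2n addnn addn0.
have [s1 s2] := size_pE; have bf n := bform_even uN u0 n.
(* One loop: [pskew (v 0)] is f_(-1) + f_1 + f_0 + f_2, which is [v 0 + v 1] because f_(-1) =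
   f_1. *)
apply: (@bounded_schur_sum w 0 pE1 pE2 1 v) => //.
+ by move=> n; case: (bf n).
+ by move=> n; case: (bf n).
+ by move=> n; case: (bf n) => _ _ -> ->.
+ by move=> n; case: (bf n) => _ _ -> _; rewrite /u q1 /v add0r.
+ rewrite mulr1n /v pskewD !pskew_fser sub0r !add0r fserN subrr.
  have -> : (1 + 1 : int) = 2 by [].
  ring.
+ move=> d; rewrite /v pskewD !pskew_fser.
  have -> : d.+1%:Z - 1 = d%:Z by lia.
  have -> : d.+1%:Z + 1 - 1 = d%:Z + 1 by lia.
  have -> : d.+1%:Z + 1 = d.+2%:Z by lia.
  ring.
+ by rewrite rmorphD /= !coef0_fser addr0.
+ by move=> d; rewrite rmorphD /= !coef0_fser addr0.
Qed.
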